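(* Let $X$ be a proper CAT$(-1)$ space, let $\Gamma\le\operatorname{Isom}(X)$ be finitely generated, non-elementary and discrete with $0<\delta_X(\Gamma)<\infty$, let $A,B\in\Lambda_\Gamma$ be distinct and let $o$ be a point on the geodesic $(A,B)$. Let $\{(H_\beta,\mathcal G_\beta)\}_{\beta\in I}$ be an arbitrary nonempty (possibly infinite) family in which each $H_\beta\le\Gamma$ and $\mathcal G_\beta$ is a finite connected graph of groups with fundamental group $H_\beta$; no nesting, uniform bound or compatibility between different $\beta$ is assumed. For every $\beta\in I$: (1) The critical exponent of the Bass–Serre normal-form length satisfies $$\delta^{\mathrm{BS}}_{\beta,o}=\max\Big\{\delta_{\beta,\mathrm{coef}}(o),\ \max_{C\in\mathscr C_\beta}\sup_F\sigma^{\mathrm{rel}}_{\beta,C,F}(o)\Big\},$$ where $F$ ranges over finite sets of allowed transitions in $C$ (maxima and suprema over empty collections are $0$). (2) For every $C\in\mathscr C_\beta$, every entry of $K_{\beta,C,o}(\delta_X(\Gamma))$ is finite, $\rho(K_{\beta,C,o}(s))<1$ for every $s>\delta_X(\Gamma)$, and $$\rho\big(K_{\beta,C,o}(\delta_X(\Gamma))\big)\le1.$$ (3) For every $C\in\mathscr C_\beta$, every finite choice $\mathcal F$ of hyperbolic representatives in $C$, and every $s>0$, $$0\le A^{\mathcal F}_{\beta,C,o}(s)\le K^{\mathcal F}_{\beta,C,o}(s)\ \text{ entrywise},\qquad \sigma^{\mathrm{ax}}_{\beta,C,\mathcal F}(o)\le\sigma^{\mathrm{rel}}_{\beta,C,\mathcal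 F}(o)\le\delta_X(\Gamma).$$ The same assertions hold at every (nonterminal) node of each chosen finite graph-of-groups hierarchy of subgroups of $\Gamma$, that is, for the pair consisting of the node subgroup and its chosen graph-of-groups decomposition.
   Context: $\delta_X(\Gamma)=\inf\{s>0:\sum_{g\in\Gamma}e^{-sd(o,go)}<\infty\}$; $\Lambda_\Gamma$ is the limit set. A finite graph-of-groups hierarchy is a finite rooted tree of subgroups in which every nonterminal node $H$ carries a finite graph-of-groups decomposition with fundamental group $H$ and selected vertex groups become its children. Data attached to a pair $(H,\mathcal G)$ and basepoint $x\in X$ (for $(H_\beta,\mathcal G_\beta)$ and $x=o$ all objects carry the extra subscript $\beta$ and $o$). $\mathcal G$ has finite underlying graph $Y$ and Bass–Serre tree $T$ ($H$ acts without inversions, $H\backslash T=Y$). For an oriented edge $f$ of $Y$: origin $\iota(f)$, terminus $t(f)$, reverse $\bar f$. Fix a base vertex $v_*$ of $Y$, a lift $\tilde v\in T$ of each vertex $v$, a lift $\tilde f$ of each oriented edge $f$ with origin $\widetilde{\iota(f)}$, and $\tau_f\in H$ with $t(\tilde f)=\tau_f\widetilde{t(f)}$, chosen so that $\widetilde{\bar f}=\tau_f^{-1}\overline{\tilde f}$ and $\tau_{\bar f}=\tau_f^{-1}$. Put $G_v=\operatorname{Stab}_H(\tilde v)$, $G_f=\operatorname{Stab}_H(\tilde f)\le G_{\iota(f)}$. For $c=rG_f\in G_{\iota(f)}/G_f$ let $L_{f,x}(c)=\min_{h\in G_f}d(x,rh\tau_fx)$ (the minimum exists); choose $h_f(c)$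 attaining it and put $b_f(c)=rh_f(c)\tau_f$. An allowed transition is a triple $(e,f,c)$ of oriented edges $e,f$ with $t(e)=\iota(f)$ and $c\in G_{\iota(f)}/G_f$, where $c\ne G_f$ is required if $f=\bar e$. Let $K_{ef,x}(s)=\sum_{c:(e,f,c)\text{ allowed}}e^{-sL_{f,x}(c)}\in[0,\infty]$ (zero if $t(e)\ne\iota(f)$). A reduced coset-labelled loop based at $v_*$ is a sequence $(f_1,c_1;\dots;f_n,c_n)$, $c_j\in G_{\iota(f_j)}/G_{f_j}$, with $\iota(f_1)=v_*=t(f_n)$ and all $(f_j,f_{j+1},c_{j+1})$ allowed. $E_*$ is the set of oriented edges occurring in some such loop, and $K_{*,x}(s)$ (the trim matrix) is the restriction of $K_x(s)$ to $E_*$. Normal form: every $h\in H$ is uniquely $h=b_{f_1}(c_1)\cdots b_{f_n}(c_n)h_*$ with $(f_1,c_1;\dots;f_n,c_n)$ a reduced coset-labelled loop based at $v_*$ ($n\ge0$) and $h_*\in G_{v_*}$. Set $L^{\mathrm{BS}}_x(h)=\sum_jL_{f_j,x}(c_j)+d(x,h_*x)$ and $\delta^{\mathrm{BS}}_x=\inf\{s>0:\sum_{h\in H}e^{-sL^{\mathrm{BS}}_x(h)}<\infty\}$. Coefficient series: $V_x(s)=\sum_{h\in G_{v_*}}e^{-sd(x,hx)}$ and, for $f\in E_*$, $(u_x(s))_f=\sum_{c\in G_{v_*}/G_f}e^{-sL_{f,x}(c)}$ if $\iota(f)=v_*$ and $0$ otherwise. $\delta_{\mathrm{coef}}(x)$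 is the infimum of the $s>0$ for which $V_x(s)$ and all entries of $u_x(s)$ and $K_{*,x}(s)$ are finite. Blocks: $\mathscr C$ is the set of strongly connected components $C\subseteq E_*$ of the support digraph of $K_{*,x}$ that contain a directed closed walk of positive length; $K_{C,x}(s)$ is the diagonal block of $K_{*,x}(s)$ on $C$. For a finite set $F$ of allowed transitions between states of $C$, $K^F_{C,x}(s)$ is the matrix obtained by retaining exactly the transitions in $F$. With $\rho$ the spectral radius, $\sigma^{\mathrm{rel}}_{C,F}(x)=\inf\{s>0:\rho(K^F_{C,x}(s))<1\}$. Hyperbolic representatives: an isometry $g$ is hyperbolic if $\tau_X(g)=\inf_zd(z,gz)$ is positive and attained; it then has a unique geodesic axis $\operatorname{Ax}(g)$, and $a_x(g)=\tau_X(g)+2d(x,\operatorname{Ax}(g))$. A finite choice $\mathcal F$ of hyperbolic representatives in $C$ consists, for each $e,f\in C$, of a finite set $\mathcal F_{ef}$ of distinct cosets $c$ with $(e,f,c)$ allowed and, for each $c=rG_f\in\mathcal F_{ef}$, one hyperbolic element $g_{ef,c}=rh\tau_f$ with $h\in G_f$ (only cosets admitting such an element may be selected). Put $K^{\mathcal F}_{C,x}(s)_{ef}=\sum_{c\in\mathcal F_{ef}}e^{-sL_{f,x}(c)}$, $A^{\mathcal F}_{C,x}(s)_{ef}=\sum_{c\in\mathcal F_{ef}}e^{-sa_x(g_{ef,c})}$, $\sigma^{\mathrm{rel}}_{C,\mathcal F}(x)=\inf\{s>0:\rho(K^{\mathcal F}_{C,x}(s))<1\}$, $\sigma^{\mathrm{ax}}_{C,\mathcal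 F}(x)=\inf\{s>0:\rho(A^{\mathcal F}_{C,x}(s))<1\}$. *)

(* Defs.v *)
From HB Require Import structures.
From mathcomp Require Import all_boot all_order all_algebra.
From mathcomp Require Import complex.
From mathcomp Require Import all_classical all_reals all_analysis.
Set Implicit Arguments.
Unset Strict Implicit.
Unset Printing Implicit Defensive.
Import Order.TTheory GRing.Theory Num.Theory.
Local Open Scope classical_set_scope.
Local Open Scope ring_scope.

Definition geodesic_path (R : realType) (T : Type) (dist : T -> T -> R)
    (x y : T) (c : R -> T) : Prop :=
  [/\ c 0 = x, c (dist x y) = y &
      forall s t, 0 <= s <= dist x y -> 0 <= t <= dist x y ->
        dist (c s) (c t) = `|s - t| ].

(* Side [i] joins vertex [i] to vertex [i + 1], the indices being mod 3. *)
Definition geodesic_triangle (R : realType) (T : Type) (dist : T -> T -> R)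
    (v : 'I_3 -> T) (c : 'I_3 -> R -> T) : Prop :=
  forall i, geodesic_path dist (v i) (v (i + 1)) (c i).

(* The upper half-plane model of the hyperbolic plane of curvature -1 *)

Record hplane (R : realType) :=
  HPlane { hre : R; him : R; him_gt0 : 0 < him }.

Definition arcosh (R : realType) (t : R) : R := ln (t + Num.sqrt (t ^+ 2 - 1)).

Definition hdist (R : realType) (p q : hplane R) : R :=
  arcosh (1 + ((hre p - hre q) ^+ 2 + (him p - him q) ^+ 2)
              / (2 * him p * him q)).

Section Spaces.
Context {R : realType}.

Definition proper_space (X : metricType R) : Prop :=
  forall (x : X) (r : R), compact [set y : X | mdist x y <= r].

Definition cat_minus1 (X : metricType R) : Prop :=
  (forall x y : X, exists c, geodesic_path mdist x y c) /\
  (forall (v : 'I_3 -> X) c (v' : 'I_3 -> hplane R) c',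
    geodesic_triangle mdist v c -> geodesic_triangle (@hdist R) v' c' ->
    (forall i, hdist (v' i) (v' (i + 1)) = mdist (v i) (v (i + 1))) ->
    forall i j s t,
      0 <= s <= mdist (v i) (v (i + 1)) -> 0 <= t <= mdist (v j) (v (j + 1)) ->
      mdist (c i s) (c j t) <= hdist (c' i s) (c' j t)).

(* The isometry group, with (g * h) x = g (h x) *)

Record isom (X : metricType R) := Isom {
  isom_fun :> X -> X;
  isom_dist : forall x y, mdist (isom_fun x) (isom_fun y) = mdist x y;
  isom_surj : forall y, exists x, isom_fun x = y }.

End Spaces.

HB.instance Definition _ (R : realType) (X : metricType R) :=
  gen_eqMixin (isom X).
HB.instance Definition _ (R : realType) (X : metricType R) :=
  gen_choiceMixin (isom X).

Section IsomGroup.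
Context {R : realType} {X : metricType R}.

Lemma isom_ext (g h : isom X) : (forall x, g x = h x) -> g = h.
Proof.
case: g h => [g gd gs] [h hd hs] /= gh.
have e : g = h by apply/funext.
subst h; congr Isom; exact: Prop_irrelevance.
Qed.

Definition isom_id : isom X :=
  Isom (fun x y => erefl (mdist (id x) (id y))) (fun y => ex_intro _ y erefl).

Lemma isom_comp_dist (g h : isom X) x y :
  mdist ((g \o h) x) ((g \o h) y) = mdist x y.
Proof. by rewrite /= !isom_dist. Qed.

Lemma isom_comp_surj (g h : isom X) y : exists x, (g \o h) x = y.
Proof.
have [z <-] := isom_surj g y; have [x <-] := isom_surj h z.
by exists x.
Qed.

Definition isom_comp (g h : isom X) : isom X :=
  Isom (isom_comp_dist g h) (isom_comp_surj g h).

Definition isom_invfun (g : isom X) (y : X) : X := projT1 (cid (isom_surj g y)).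

Lemma isom_invfunK (g : isom X) y : g (isom_invfun g y) = y.
Proof. exact: projT2 (cid (isom_surj g y)). Qed.

Lemma isom_inj (g : isom X) : injective g.
Proof.
move=> x y gxy; apply: mdist_positivity.
by rewrite -(isom_dist g) gxy mdistxx.
Qed.

Lemma isom_inv_dist (g : isom X) x y :
  mdist (isom_invfun g x) (isom_invfun g y) = mdist x y.
Proof. by rewrite -(isom_dist g) !isom_invfunK. Qed.

Lemma isom_inv_surj (g : isom X) y : exists x, isom_invfun g x = y.
Proof. by exists (g y); apply: (@isom_inj g); rewrite isom_invfunK. Qed.

Definition isom_inv (g : isom X) : isom X :=
  Isom (isom_inv_dist g) (isom_inv_surj g).

Lemma isom_mulA : associative isom_comp.
Proof. by move=> f g h; apply: isom_ext. Qed.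

Lemma isom_mul1 : left_id isom_id isom_comp.
Proof. by move=> g; apply: isom_ext. Qed.

Lemma isom_mulr1 : right_id isom_id isom_comp.
Proof. by move=> g; apply: isom_ext. Qed.

Lemma isom_mulV : left_inverse isom_id isom_inv isom_comp.
Proof.
by move=> g; apply: isom_ext => x; apply: (@isom_inj g); rewrite /= isom_invfunK.
Qed.

Lemma isom_mulrV : right_inverse isom_id isom_inv isom_comp.
Proof. by move=> g; apply: isom_ext => x; rewrite /= isom_invfunK. Qed.

End IsomGroup.

HB.instance Definition _ (R : realType) (X : metricType R) :=
  isGroup.Build (isom X) isom_mulA isom_mul1 isom_mulr1 isom_mulV isom_mulrV.

Definition subgroup (G : groupType) (A : set G) : Prop :=
  [/\ A 1%g, (forall x y, A x -> A y -> A (x * y)%g)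
    & forall x, A x -> A (x^-1)%g].

Definition finitely_generated (G : groupType) (A : set G) : Prop :=
  exists2 S : set G, finite_set S & A = smallest (@subgroup G) S.

Definition lcoset (G : groupType) (r : G) (A : set G) : set G :=
  [set (r * a)%g | a in A].

Section Groups.
Context {R : realType} {X : metricType R}.
Implicit Types (x o : X) (g h : isom X) (Gam H : set (isom X)).

(* The subspace topology induced on Gam by the compact-open topology of
   Isom(X) is discrete. *)
Definition discrete_isom Gam : Prop :=
  forall g, Gam g -> exists2 U : set {compact-open, X -> X}, open U &
    [set h | Gam h /\ U (isom_fun h)] = [set g].

(* The boundary at infinity: a boundary point is an asymptoty class of geodesic
   rays, encoded as a set of functions of which only the values on [0, +oo[
   matter. *)
Definition geodesic_ray (c : R -> X) : Prop :=
  forall s t, 0 <= s -> 0 <= t -> mdist (c s) (c t) = `|s - t|.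

Definition asymptotic (c c' : R -> X) : Prop :=
  exists K, forall t, 0 <= t -> mdist (c t) (c' t) <= K.

Definition boundary : set (set (R -> X)) :=
  [set xi | exists2 c, geodesic_ray c &
                       xi = [set c' | geodesic_ray c' /\ asymptotic c c']].

(* Convergence in the cone topology of a sequence of points to a boundary
   point, seen from p: the geodesic paths from p to the points converge,
   uniformly on compact intervals, to the ray from p in the class xi. *)
Definition cone_cvg (p : X) (u : nat -> X) (xi : set (R -> X)) : Prop :=
  exists c, [/\ xi c, c 0 = p &
    forall cs : nat -> R -> X, (forall n, geodesic_path mdist p (u n) (cs n)) ->
    forall T e : R, 0 < T -> 0 < e -> exists N, forall n, (N <= n)%N ->
      T <= mdist p (u n) /\
      forall t, 0 <= t <= T -> mdist (cs n t) (c t) < e].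

Definition limit_set Gam : set (set (R -> X)) :=
  [set xi | boundary xi /\ exists (p : X) (g : nat -> isom X),
     (forall n, Gam (g n)) /\ cone_cvg p (fun n => g n p) xi].

Definition non_elementary Gam : Prop :=
  exists a b c, [/\ limit_set Gam a, limit_set Gam b & limit_set Gam c]
             /\ [/\ a <> b, b <> c & a <> c].

Definition geodesic_line (c : R -> X) : Prop :=
  forall s t, mdist (c s) (c t) = `|s - t|.

(* o lies on the geodesic (A, B) with endpoints A and B at infinity. *)
Definition on_geodesic (A B : set (R -> X)) (o : X) : Prop :=
  exists c, [/\ geodesic_line c, A (fun t => c (- t)), B c & exists t, c t = o].

(* inf {s > 0 : P s} as an extended real, +oo if there is no such s *)
Definition inf_pos (P : R -> Prop) : \bar R :=
  ereal_inf [set s%:E | s in [set s | 0 < s /\ P s]].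

Definition critical_exponent o Gam : \bar R :=
  inf_pos (fun s =>
    (\esum_(g in Gam) (expR (- s * mdist o (g o)))%:E < +oo)%E).

Definition transl_length g : R := inf [set mdist z (g z) | z in [set: X]].

Definition hyperbolic g : Prop :=
  0 < transl_length g /\ exists z, mdist z (g z) = transl_length g.

Definition is_axis g (A : set X) : Prop :=
  exists c, [/\ geodesic_line c, forall t, g (c t) = c (t + transl_length g)
              & A = range c].

(* For a hyperbolic g of a CAT(-1) space this is the unique axis of g. *)
Definition axis g : set X := xget set0 (is_axis g).

Definition dist_to (x : X) (A : set X) : R := inf [set mdist x z | z in A].

Definition axis_length x g : R := transl_length g + 2 * dist_to x (axis g).

End Groups.

Section SpectralRadius.
Context {R : realType}.

Definition spectral_radius_real n (M : 'M[R]_n) : R :=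
  sup [set complex.Re `|l| | l in
        [set l : R[i] | eigenvalue (map_mx (fun r : R => r%:C%C) M) l]].

(* For matrices with entries in [0, +oo]; the value is +oo as soon as some
   entry is infinite. *)
Definition spectral_radius n (M : 'M[\bar R]_n) : \bar R :=
  if [forall i, forall j, M i j \is a fin_num]
  then (spectral_radius_real (map_mx fine M))%:E else +oo%E.

Definition block (E : finType) (C : {set E}) (M : E -> E -> \bar R) :
    'M[\bar R]_#|C| :=
  \matrix_(i, j) M (enum_val i) (enum_val j).

End SpectralRadius.

(* Graphs in the sense of Serre, with oriented edges *)

Record sgraph (V E : Type) := SGraph {
  orig : E -> V;
  erev : E -> E;
  erevK : forall e, erev (erev e) = e;
  erev_neq : forall e, erev e <> e }.

Definition term (V E : Type) (Y : sgraph V E) (e : E) : V := orig Y (erev Y e).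

Fixpoint walk (V E : Type) (Y : sgraph V E) (x : V) (p : seq E) (y : V) : Prop :=
  if p is e :: p' then orig Y e = x /\ walk Y (term Y e) p' y else x = y.

Fixpoint reduced (V E : Type) (Y : sgraph V E) (p : seq E) : Prop :=
  if p is e :: p' then
    (if p' is f :: _ then f <> erev Y e else True) /\ reduced Y p'
  else True.

Definition is_tree (V E : Type) (Y : sgraph V E) : Prop :=
  (forall x y, exists p, walk Y x p y) /\
  (forall x p, walk Y x p x -> reduced Y p -> p = [::]).

(* A graph-of-groups decomposition of a subgroup H of Isom(X), given by its
   Bass-Serre tree T, together with the choices of a base vertex, lifts and
   transporting elements. The underlying finite graph is Y = H \ T, which is
   connected since T is. The actions are only meaningful for elements of H. *)
Record graph_of_groups (R : realType) (X : metricType R) (H : set (isom X)) :=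
  GraphOfGroups {
  vert : finType;
  edge : finType;
  graph : sgraph vert edge;
  tvert : Type;
  tedge : Type;
  tree : sgraph tvert tedge;
  tree_is_tree : is_tree tree;
  actV : isom X -> tvert -> tvert;
  actE : isom X -> tedge -> tedge;
  actV1 : forall a, actV 1%g a = a;
  actE1 : forall e, actE 1%g e = e;
  actVM : forall g h a, H g -> H h -> actV (g * h)%g a = actV g (actV h a);
  actEM : forall g h e, H g -> H h -> actE (g * h)%g e = actE g (actE h e);
  act_orig : forall g e, H g -> orig tree (actE g e) = actV g (orig tree e);
  act_rev : forall g e, H g -> erev tree (actE g e) = actE g (erev tree e);
  no_inversion : forall g e, H g -> actE g e <> erev tree e;
  projV : tvert -> vert;
  projE : tedge -> edge;
  proj_orig : forall e, projV (orig tree e) = orig graph (projE e);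
  proj_rev : forall e, projE (erev tree e) = erev graph (projE e);
  projV_orbit : forall a b,
    projV a = projV b <-> exists2 h, H h & b = actV h a;
  projE_orbit : forall e f,
    projE e = projE f <-> exists2 h, H h & f = actE h e;
  base : vert;
  liftV : vert -> tvert;
  liftE : edge -> tedge;
  tau : edge -> isom X;
  liftV_proj : forall v, projV (liftV v) = v;
  liftE_proj : forall f, projE (liftE f) = f;
  liftE_orig : forall f, orig tree (liftE f) = liftV (orig graph f);
  tau_in : forall f, H (tau f);
  tau_term : forall f, term tree (liftE f) = actV (tau f) (liftV (term graph f));
  liftE_rev : forall f,
    liftE (erev graph f) = actE ((tau f)^-1)%g (erev tree (liftE f));
  tau_rev : forall f, tau (erev graph f) = ((tau f)^-1)%g }.

Arguments actV {R X H} _ _ _.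
Arguments actE {R X H} _ _ _.
Arguments projV {R X H} _ _.
Arguments projE {R X H} _ _.
Arguments liftV {R X H} _ _.
Arguments liftE {R X H} _ _.
Arguments tau {R X H} _ _.

Section Data.
Context {R : realType} {X : metricType R} {H : set (isom X)}.
Variable D : graph_of_groups H.
Implicit Types (e f : edge D) (v : vert D) (c : set (isom X)) (s : R) (x : X).

Definition vgroup v : set (isom X) :=
  [set h | H h /\ actV D h (liftV D v) = liftV D v].

Definition egroup f : set (isom X) :=
  [set h | H h /\ actE D h (liftE D f) = liftE D f].

(* the set of cosets G_{iota(f)} / G_f *)
Definition ecosets f : set (set (isom X)) :=
  [set lcoset r (egroup f) | r in vgroup (orig (graph D) f)].

(* For c = r G_f the set {d(x, r h tau_f x) : h in G_f}, whose minimum is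
   L_{f,x}(c) *)
Definition edge_length x f c : R :=
  inf [set mdist x ((g * tau D f)%g x) | g in c].

(* A choice c = r G_f |-> r h_f(c) of elements attaining L_{f,x}(c) *)
Definition minimizing_choice x (m : edge D -> set (isom X) -> isom X) : Prop :=
  forall f c, ecosets f c ->
    c (m f c) /\ mdist x ((m f c * tau D f)%g x) = edge_length x f c.

Definition transition : Type := (edge D * edge D * set (isom X))%type.

Definition allowed : set transition :=
  [set t | let: (e, f, c) := t in
    [/\ term (graph D) e = orig (graph D) f, ecosets f c
      & f = erev (graph D) e -> c <> egroup f]].

(* The transition matrix restricted to a set F of transitions *)
Definition Kmat_on x (F : set transition) s e f : \bar R :=
  (\esum_(c in [set c | F (e, f, c)]) (expR (- s * edge_length x f c))%:E)%E.

Definition Kmat x : R -> edge D -> edge D -> \bar R := Kmat_on x allowed.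

Fixpoint coset_path e (w : seq (edge D * set (isom X))) : Prop :=
  if w is (f, c) :: w' then allowed (e, f, c) /\ coset_path f w'
  else term (graph D) e = base D.

(* Reduced coset-labelled loops at the base vertex, including the empty one *)
Definition reduced_loop (w : seq (edge D * set (isom X))) : Prop :=
  if w is (f, c) :: w' then
    [/\ orig (graph D) f = base D, ecosets f c & coset_path f w']
  else True.

(* The trimmed state set E_* *)
Definition trim : {set edge D} :=
  [set f | `[< exists2 w, reduced_loop w & f \in map fst w >]].

Definition normal_form (m : edge D -> set (isom X) -> isom X) (h : isom X)
    (w : seq (edge D * set (isom X)) * isom X) : Prop :=
  [/\ reduced_loop w.1, vgroup (base D) w.2
    & h = (\prod_(fc <- w.1) (m fc.1 fc.2 * tau D fc.1) * w.2)%g].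

Definition BS_length x m (h : isom X) : R :=
  let w := xget ([::], 1%g) (normal_form m h) in
  \sum_(fc <- w.1) edge_length x fc.1 fc.2 + mdist x (w.2 x).

Definition BS_exponent x m : \bar R :=
  inf_pos (fun s =>
    (\esum_(h in H) (expR (- s * BS_length x m h))%:E < +oo)%E).

Definition Vcoef x s : \bar R :=
  (\esum_(h in vgroup (base D)) (expR (- s * mdist x (h x)))%:E)%E.

Definition ucoef x s f : \bar R :=
  if orig (graph D) f == base D
  then (\esum_(c in ecosets f) (expR (- s * edge_length x f c))%:E)%E else 0%E.

Definition coef_exponent x : \bar R :=
  inf_pos (fun s => [/\ (Vcoef x s < +oo)%E,
    forall f, f \in trim -> (ucoef x s f < +oo)%E
    & forall e f, e \in trim -> f \in trim -> (Kmat x s e f < +oo)%E]).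

(* Support digraph of the trim matrix *)
Definition support x : rel (edge D) := fun e f =>
  [&& e \in trim, f \in trim & `[< exists2 s, 0 < s & Kmat x s e f != 0%E >]].

(* The strongly connected components of the support digraph containing a
   directed closed walk of positive length *)
Definition components x : {set {set edge D}} :=
  [set C : {set edge D} |
    [exists e in trim,
      C == [set f in trim | connect (support x) e f && connect (support x) f e]]
    && `[< exists p, [/\ p != [::], cycle (support x) p
                       & forall e, e \in p -> e \in C] >]].

Definition transitions_in (C : {set edge D}) : set transition :=
  [set t | [/\ allowed t, t.1.1 \in C & t.1.2 \in C]].

Definition sigma_rel x (C : {set edge D}) (F : set transition) : \bar R :=
  inf_pos (fun s => (spectral_radius (block C (Kmat_on x F s)) < 1)%E).

(* A finite choice of hyperbolic representatives in C: a finite set F of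
   transitions in C and, for each (e, f, r G_f) in F, a hyperbolic element of
   r G_f tau_f *)
Definition hyperbolic_choice (C : {set edge D}) (F : set transition)
    (g : transition -> isom X) : Prop :=
  [/\ finite_set F, F `<=` transitions_in C &
      forall e f c, F (e, f, c) -> hyperbolic (g (e, f, c)) /\
        exists2 k, c k & g (e, f, c) = (k * tau D f)%g].

Definition Amat x (F : set transition) (g : transition -> isom X) s e f :
    \bar R :=
  (\esum_(c in [set c | F (e, f, c)])
     (expR (- s * axis_length x (g (e, f, c))))%:E)%E.

Definition sigma_ax x (C : {set edge D}) (F : set transition)
    (g : transition -> isom X) : \bar R :=
  inf_pos (fun s => (spectral_radius (block C (Amat x F g s)) < 1)%E).

Definition BS_exponent_formula x (m : edge D -> set (isom X) -> isom X) : Prop :=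
  BS_exponent x m =
  Order.max (coef_exponent x)
    (\big[Order.max/0%E]_(C in components x)
       ereal_sup [set sigma_rel x C F | F in
         [set F | finite_set F /\ F `<=` transitions_in C]]).

(* Here and below delta stands for the critical exponent of the ambient group. *)
Definition block_bound x (delta : R) : Prop :=
  forall C, C \in components x ->
    [/\ forall e f, e \in C -> f \in C -> Kmat x delta e f \is a fin_num,
        forall s, delta < s -> (spectral_radius (block C (Kmat x s)) < 1)%E
      & (spectral_radius (block C (Kmat x delta)) <= 1)%E].

Definition axis_comparison x (delta : R) : Prop :=
  forall C, C \in components x ->
  forall (F : set transition) (g : transition -> isom X),
    hyperbolic_choice C F g ->
    (forall s, 0 < s -> forall e f, e \in C -> f \in C ->
       (0 <= Amat x F g s e f)%E /\ (Amat x F g s e f <= Kmat_on x F s e f)%E) /\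
    (sigma_ax x C F g <= sigma_rel x C F)%E /\
    (sigma_rel x C F <= delta%:E)%E.

Definition BS_assertions x (delta : R) : Prop :=
  [/\ forall m, minimizing_choice x m -> BS_exponent_formula x m,
      block_bound x delta & axis_comparison x delta].

End Data.

(* Finite graph-of-groups hierarchies; at a nonterminal node, sel is the set of
   vertices whose vertex groups are selected as children. *)
Inductive hierarchy (R : realType) (X : metricType R) (H : set (isom X)) : Type :=
| Terminal
| Node (D : graph_of_groups H) (sel : {set vert D})
    (children : forall v : vert D, v \in sel -> hierarchy (vgroup v)).

Fixpoint all_nonterminal (R : realType) (X : metricType R)
    (P : forall H : set (isom X), graph_of_groups H -> Prop)
    (H : set (isom X)) (T : hierarchy H) : Prop :=
  match T with
  | Terminal => True
  | Node D sel children =>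
      P H D /\ forall v (vS : v \in sel), all_nonterminal P (children v vS)
  end.

(* Main.v *)
From Pilot Require Import Defs.
From mathcomp Require Import all_boot all_order all_algebra.
From mathcomp Require Import finmap complex.
From mathcomp Require Import all_classical all_reals all_analysis.
From mathcomp Require Import spectral ring lra zify.
Import Order.TTheory GRing.Theory Num.Theory.
Local Open Scope classical_set_scope.
Local Open Scope ring_scope.

(** Everything is read off from sums over words. A path between two states of
    the graph is a word of letters (f, c), and multiplying the chosen elements
    of its letters gives an element of [H]. The word traces an edge path in the
    Bass-Serre tree; the excluded transitions are exactly the backtrackings, so
    this path is reduced, and since a tree has one reduced path between two
    vertices the word can be recovered from the element
    ([word_elt_inj], [normal_form_exists]). On the other hand the path sums of
    length [n] between states of a block are the entries of the [n]-th power of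
    its matrix ([psumE]). So convergence of a group series and the spectral
    radius of a matrix are two views of the same sums.

    The passage between the two views is elementary linear algebra: the spectral
    radius is below 1 exactly when the powers decay ([spectral_radius_lt1],
    [spectral_radius_pow_decay], the latter by Schur triangularization), and for
    a nonnegative matrix with bounded powers the diagonal entries of all powers
    are at most 1, because a closed path can be repeated
    ([nneg_mx_pow_diag_le1]). Monotonicity of the spectral radius below the
    value 1 follows without any Perron-Frobenius theory.

    Block bound. The product of a word moves [o] by at most the length of the
    word, so for s > delta every path sum is at most the Poincare series of the
    ambient group ([path_sum_le_poincare]) and all blocks have spectral radius
    below 1. Hence the closed path sums of each length are at most 1 for
    s > delta, and by continuity of finite sums also at delta ([psum_limit]).
    Strong connectedness turns this into a bound on all entries of all powers of
    the block at delta ([psum_critical_bounded]): they are finite and the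
    spectral radius is at most 1.

    Formula for the normal-form exponent ([BS_exponent_formulaP]). If the
    normal-form series converges at [s], then, since every trimmed state lies on
    a loop, so do all coefficient series and all path sums, and every finite
    truncation of every block has spectral radius below 1. Conversely let [s]
    exceed the right-hand side. A closed path uses finitely many transitions, so
    slightly below [s] the closed path sums of each length are at most 1
    ([psum_closed_le1_finite]). A letter may have length 0, but only finitely
    many words have total length at most 1, again by comparison with a
    convergent Poincare series; so the length of a word grows linearly with its
    number of letters ([wlen_ge_div]) and raising the exponent to [s] gains a
    geometric factor: the closed paths at each state have a finite sum
    ([closed_paths_lty]). Removing the states one at a time, by splitting paths
    at their last visit, all path sums are finite ([summable_paths_of_closed]),
    and the normal form factors the series into finite pieces
    ([coef_paths_BS_summable]).

    Axis comparison. The entrywise inequality says that the displacement of [o]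
    by a hyperbolic [g] is at most the translation length plus twice the
    distance from [o] to the axis; what has to be shown is that the axis exists.
    If z is displaced minimally, by tau, the midpoint m of a segment from z to
    g z is displaced by at least tau, and by CAT(-1) comparison with an
    isosceles triangle by at most half the distance from z to g^2 z
    ([midpoint_displacement]). So g^2 displaces z by 2 tau, which is again
    minimal, and iterating, g^(2^k) displaces z by 2^k tau: the translates of
    the segment form a geodesic line ([hyperbolic_axis_exists]). *)

Set Implicit Arguments.
Unset Strict Implicit.
Unset Printing Implicit Defensive.

(** * Spectral radius and powers of a matrix *)

Section ComplexMatrices.
Context {R : realType}.
Local Notation C := R[i].
(** Real-valued, so that moduli are totally ordered and can be maximized. *)
Definition cnorm (z : C) : R := complex.Re `|z|.
Local Notation nrm z := (cnorm z).
Arguments cnorm : simpl never.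

Lemma nrm_ge0 (z : C) : 0 <= nrm z.
Proof. rewrite -lecR; exact: (normr_ge0 z). Qed.
Lemma nrmM (x y : C) : nrm (x * y) = nrm x * nrm y.
Proof. by apply: (@complexI R); rewrite rmorphM; exact: normrM. Qed.
Lemma nrmX (x : C) k : nrm (x ^+ k) = nrm x ^+ k.
Proof. by apply: (@complexI R); rewrite rmorphXn; exact: normrX. Qed.
Lemma nrm_sum (I : finType) (F : I -> C) : nrm (\sum_i F i) <= \sum_i nrm (F i).
Proof.
rewrite -lecR rmorph_sum.
exact: (@ler_norm_sum _ _ _ (index_enum I) F xpredT).
Qed.
Lemma nrm_real (x : R) : nrm (x%:C)%C = `|x|.
Proof. by rewrite /cnorm /= expr0n addr0 sqrtr_sqr. Qed.
Lemma nrm_eq0 (x : C) : (nrm x == 0) = (x == 0).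
Proof. by rewrite -[RHS]normr_eq0 -(inj_eq (@complexI R)). Qed.
Lemma nrm0 : nrm (0 : C) = 0.
Proof. by apply/eqP; rewrite nrm_eq0. Qed.
Lemma nrm1 : nrm (1 : C) = 1.
Proof. by rewrite (nrm_real 1) normr1. Qed.

Lemma eigen_pow_mx n (M : 'M[C]_n) l (v : 'rV[C]_n) k :
  v *m M = l *: v -> v *m (M ^+ k) = l ^+ k *: v.
Proof.
move=> vM; elim: k => [|k IH]; first by rewrite expr0 mulmx1 scale1r.
by rewrite exprSr mulmxA IH -scalemxAl vM scalerA exprSr.
Qed.

Lemma eigenvalue_pow_bound n (M : 'M[C]_n) l k (K : R) :
  eigenvalue M l -> (forall i j, nrm ((M ^+ k) i j) <= K) ->
  nrm l ^+ k <= n%:R * K.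
Proof.
move=> /eigenvalueP[v vM v0] MK.
pose S := \sum_i nrm (v 0 i).
have S0 : 0 < S.
  rewrite lt_def sumr_ge0 ?andbT; last by move=> i _; exact: nrm_ge0.
  apply: contra v0 => /eqP S0; apply/eqP/rowP => i; rewrite mxE; apply/eqP.
  rewrite -nrm_eq0; apply/eqP.
  by apply: (psumr_eq0P (P := predT) (F := fun i => nrm (v 0 i))) => // j _;
    exact: nrm_ge0.
rewrite -(ler_pM2r S0).
rewrite -nrmX [leLHS]mulr_sumr.
have -> : \sum_i nrm (l ^+ k) * nrm (v 0 i) = \sum_j nrm ((v *m (M ^+ k)) 0 j).
  by apply: eq_bigr => i _; rewrite (eigen_pow_mx _ vM) mxE nrmM.
apply: (@le_trans _ _ (\sum_(j < n) K * S)); last first.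
  by rewrite sumr_const card_ord -mulrA mulr_natl.
apply: ler_sum => j _; rewrite mxE; apply: le_trans (nrm_sum _) _.
rewrite mulr_sumr; apply: ler_sum => i _.
by rewrite nrmM mulrC ler_wpM2r// nrm_ge0.
Qed.

(** The weights make it possible to treat a triangular matrix as a contraction
    as soon as its diagonal is small. *)
Lemma weighted_norm_pow n (T : 'M[C]_n) (w : 'I_n -> R) (r : R) :
  (forall i, 0 <= w i) -> 0 <= r ->
  (forall i, \sum_j nrm (T i j) * w j <= r * w i) ->
  forall k i, \sum_j nrm ((T ^+ k) i j) * w j <= r ^+ k * w i.
Proof.
move=> w0 r0 Tw; elim=> [|k IH] i.
  rewrite expr0 mul1r (bigD1 i)//= big1 => [|j ji].
    by rewrite addr0 mxE eqxx nrm1 mul1r.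
  by rewrite mxE eq_sym (negbTE ji) nrm0 mul0r.
apply: (@le_trans _ _ (\sum_l nrm (T i l) * (\sum_j nrm ((T ^+ k) l j) * w j))).
  under [leRHS]eq_bigr do rewrite mulr_sumr.
  rewrite exchange_big/=; apply: ler_sum => j _; rewrite exprS mxE.
  under [leRHS]eq_bigr do rewrite mulrA -nrmM.
  by rewrite -mulr_suml ler_wpM2r// nrm_sum.
apply: (@le_trans _ _ (\sum_l nrm (T i l) * (r ^+ k * w l))).
  by apply: ler_sum => l _; rewrite ler_wpM2l ?nrm_ge0.
under eq_bigr do rewrite mulrCA.
by rewrite -mulr_sumr exprSr -mulrA ler_wpM2l ?exprn_ge0.
Qed.

Lemma mulmx_nrm_bound n (A B : 'M[C]_n) (a b : R) : 0 <= a ->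
  (forall i j, nrm (A i j) <= a) -> (forall i j, nrm (B i j) <= b) ->
  forall i j, nrm ((A *m B) i j) <= n%:R * (a * b).
Proof.
move=> a0 Aa Bb i j; rewrite mxE; apply: le_trans (nrm_sum _) _.
apply: (@le_trans _ _ (\sum_(k < n) a * b)); last by rewrite sumr_const card_ord mulr_natl.
by apply: ler_sum => k _; rewrite nrmM ler_pM ?nrm_ge0.
Qed.

Lemma mx_nrm_bounded n (A : 'M[C]_n) :
  exists2 a : R, 0 <= a & forall i j, nrm (A i j) <= a.
Proof.
exists (\sum_i \sum_j nrm (A i j)).
  by apply: sumr_ge0 => i _; apply: sumr_ge0 => j _; exact: nrm_ge0.
move=> i j; rewrite (bigD1 i)//= (bigD1 j)//= -addrA lerDl addr_ge0//.
  by apply: sumr_ge0 => k _; exact: nrm_ge0.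
by apply: sumr_ge0 => k _; apply: sumr_ge0 => l _; exact: nrm_ge0.
Qed.

(** Conjugating by the powers of a large number makes the off-diagonal part of
    a triangular matrix small, so that only the diagonal matters. *)
Lemma trig_pow_decay n (T : 'M[C]_n) : is_trig_mx T ->
  (forall i, nrm (T i i) < 1) ->
  exists q K : R, [/\ 0 <= q < 1, 0 <= K & forall k i j, nrm ((T ^+ k) i j) <= K * q ^+ k].
Proof.
move=> /is_trig_mxP trT dT.
have [r /andP[r0 r1] dr] : exists2 r : R, 0 <= r < 1 & forall i, nrm (T i i) <= r.
  exists (\big[Order.max/0]_i nrm (T i i)); last by move=> i; exact: le_bigmax.
  by rewrite bigmax_ge_id/= bigmax_lt.
have [t t0 tT] := mx_nrm_bounded T.
(* With weights B^i each off-diagonal term gains a factor 1/B; this B makes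
   their sum at most (1 - r)/2, half of the room left by the diagonal. *)
pose B : R := 1 + n%:R * t * 2 / (1 - r).
have B1 : 1 <= B by rewrite /B lerDl divr_ge0 ?mulr_ge0// subr_ge0 ltW.
have B0 : 0 < B by rewrite (lt_le_trans _ B1).
pose q := (1 + r) / 2.
have q01 : 0 <= q < 1 by rewrite /q; lra.
have q0 : 0 <= q by case/andP: q01.
pose w (i : 'I_n) := B ^+ i.
have w0 i : 0 < w i by rewrite exprn_gt0.
have w1 i : 1 <= w i by rewrite exprn_ege1.
have Tw i : \sum_j nrm (T i j) * w j <= q * w i.
  rewrite (bigD1 i)//=.
  have off : \sum_(j < n | j != i) nrm (T i j) * w j <= (1 - r) / 2 * w i.
    apply: (@le_trans _ _ (\sum_(j < n | j != i) (t / B * w i))).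
      apply: ler_sum => j ji.
      have [ij|ij] := ltnP i j.
        by rewrite (trT _ _ ij) nrm0 mul0r !mulr_ge0// ?invr_ge0 ltW.
      have ji' : (j < i)%N by rewrite ltn_neqAle ij andbT.
      rewrite -mulrA ler_pM ?nrm_ge0 ?tT ?(ltW (w0 _))//.
      by rewrite ler_pdivlMl// /w -exprS ler_weXn2l.
    apply: (@le_trans _ _ (\sum_(j < n) (t / B * w i))).
      rewrite [leRHS](bigID (fun j => j != i))/= lerDl sumr_ge0// => j _.
      by rewrite !mulr_ge0 ?invr_ge0// ltW.
    have -> : \sum_(j < n) t / B * w i = n%:R * t / B * w i.
      by rewrite sumr_const card_ord -[LHS]mulr_natl !mulrA.
    rewrite ler_wpM2r ?(ltW (w0 _))//.
    rewrite ler_pdivrMr// /B.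
    have : 0 < 1 - r by rewrite subr_gt0.
    move=> r1'; rewrite mulrDr mulr1.
    have -> : (1 - r) / 2 * (n%:R * t * 2 / (1 - r)) = n%:R * t.
      by field; rewrite gt_eqF.
    by rewrite lerDr divr_ge0// ltW.
  have : nrm (T i i) * w i <= r * w i by rewrite ler_wpM2r ?dr ?(ltW (w0 _)).
  have -> : q * w i = r * w i + (1 - r) / 2 * w i by rewrite /q; field.
  by move=> h; exact: lerD h off.
exists q, (\sum_i w i); split=> //; first by apply: sumr_ge0 => i _; exact: ltW.
move=> k i j.
have := weighted_norm_pow (fun i => ltW (w0 i)) q0 Tw k i.
rewrite (bigD1 j)//= => h.
have nw l : 0 <= nrm ((T ^+ k) i l) * w l by rewrite mulr_ge0 ?nrm_ge0 ?ltW.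
apply: (@le_trans _ _ (nrm ((T ^+ k) i j) * w j)).
  by rewrite ler_peMr ?nrm_ge0.
apply: (@le_trans _ _ (q ^+ k * w i)).
  by apply: le_trans h; rewrite lerDl sumr_ge0.
rewrite mulrC ler_wpM2r ?exprn_ge0// (bigD1 i)//= lerDl sumr_ge0// => l _.
exact: ltW.
Qed.

Lemma conjmx_pow n (P M : 'M[C]_n) k : P \in unitmx ->
  M ^+ k = invmx P *m (conjmx P M) ^+ k *m P.
Proof.
move=> uP; have PM : conjmx P M *m P = P *m M.
  by rewrite conjumx// -!mulmxA mulVmx// mulmx1.
suff PMk : (conjmx P M) ^+ k *m P = P *m M ^+ k.
  by rewrite -mulmxA PMk mulmxA mulVmx// mul1mx.
elim: k => [|k IH]; first by rewrite !expr0 mul1mx mulmx1.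
have -> : conjmx P M ^+ k.+1 = conjmx P M ^+ k *m conjmx P M by rewrite exprSr.
have -> : M ^+ k.+1 = M ^+ k *m M by rewrite exprSr.
by rewrite -mulmxA PM [LHS]mulmxA IH mulmxA.
Qed.

(** By Schur triangularization: the diagonal entries of the triangular form are
    eigenvalues. *)
Lemma eigen_lt1_pow_decay n (M : 'M[C]_n) :
  (forall l, eigenvalue M l -> nrm l < 1) ->
  exists q K : R, [/\ 0 <= q < 1, 0 <= K & forall k i j, nrm ((M ^+ k) i j) <= K * q ^+ k].
Proof.
move=> eM; case: n M eM => [|n] M eM.
  by exists 0, 0; split=> // [|k [//]]; rewrite lexx ltr01.
have [P Pu trP] := @Schur _ _ M (ltn0Sn n).
have uP := unitarymx_unit Pu.
have dT i : nrm (conjmx P M i i) < 1.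
  apply: eM; have fP : row_free P by rewrite row_free_unit.
  apply: (eigenvalue_conjmx _ fP).
    by apply: submx_full; rewrite row_full_unit.
  rewrite -topredE /= eigenvalue_root_char char_poly_trig// /root horner_prod.
  by rewrite (bigD1 i)//= hornerXsubC subrr mul0r.
have [q [K [q01 K0 TK]]] := trig_pow_decay trP dT.
have [a a0 aP] := mx_nrm_bounded P.
have [b b0 bP] := mx_nrm_bounded (invmx P).
exists q, (n.+1%:R * (n.+1%:R * (b * K) * a)); split=> //.
  by rewrite !mulr_ge0.
move=> k i j; rewrite (conjmx_pow _ _ uP).
have q0 : 0 <= q ^+ k by rewrite exprn_ge0//; case/andP: q01.
have h1 := mulmx_nrm_bound b0 bP (TK k).
have h2 : 0 <= n.+1%:R * (b * (K * q ^+ k)) by rewrite !mulr_ge0.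
apply: le_trans (mulmx_nrm_bound h2 h1 aP i j) _.
by rewrite le_eqVlt; apply/orP; left; apply/eqP; ring.
Qed.

End ComplexMatrices.

Section RealMatrices.
Context {R : realType}.
Local Notation toC := (fun r : R => r%:C%C).

Lemma map_toC_pow n (M : 'M[R]_n) k :
  (map_mx toC M) ^+ k = map_mx toC (M ^+ k).
Proof.
elim: k => [|k IH]; first by rewrite !expr0 (map_mx1 (real_complex R)).
by rewrite !exprS IH -!mulmxE (map_mxM (real_complex R)).
Qed.

Lemma real_eigenvalue_pow_bound n (M : 'M[R]_n) l k (K : R) :
  eigenvalue (map_mx toC M) l -> (forall i j, `|(M ^+ k) i j| <= K) ->
  cnorm l ^+ k <= n%:R * K.
Proof.
move=> el MK; apply: (eigenvalue_pow_bound el) => i j.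
by rewrite map_toC_pow mxE nrm_real.
Qed.

Lemma spectral_radius_real_le n (M : 'M[R]_n) (b : R) : 0 <= b ->
  (forall l, eigenvalue (map_mx toC M) l -> cnorm l <= b) ->
  spectral_radius_real M <= b.
Proof.
move=> b0 Mb; rewrite /spectral_radius_real; set S := [set _ | _ in _].
have [->|S0] := eqVneq S set0; first by rewrite sup0.
by apply: ge_sup; [exact/set0P|move=> _ [l el <-]; exact: Mb].
Qed.

Lemma eigenvalue_le_spectral_radius n (M : 'M[R]_n) l :
  eigenvalue (map_mx toC M) l -> cnorm l <= spectral_radius_real M.
Proof.
move=> el; apply: ub_le_sup; last by exists l.
have [K K0 MK] := mx_nrm_bounded (map_mx toC M).
exists (n%:R * K) => _ [m em <-].
by have := eigenvalue_pow_bound (k := 1) em; rewrite !expr1; apply.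
Qed.

Lemma spectral_radius_pow_decay n (M : 'M[R]_n) : spectral_radius_real M < 1 ->
  exists q K : R, [/\ 0 <= q < 1, 0 <= K &
    forall k i j, `|(M ^+ k) i j| <= K * q ^+ k].
Proof.
move=> M1.
have [l el|q [K [q01 K0 MK]]] := @eigen_lt1_pow_decay _ _ (map_mx toC M).
  exact: le_lt_trans (eigenvalue_le_spectral_radius el) M1.
exists q, K; split=> // k i j.
by have := MK k i j; rewrite map_toC_pow mxE nrm_real.
Qed.

(** The gap below 1 depends only on the exponent, so it is uniform over the
    eigenvalues and survives the supremum. *)
Lemma bernoulli_half (x : R) k : (0 < k)%N -> 0 <= x -> x ^+ k <= 2^-1 ->
  x <= 1 - (2 * k%:R)^-1.
Proof.
move=> k0 x0 xk; rewrite leNgt; apply/negP => h.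
have k0' : 0 < k%:R :> R by rewrite ltr0n.
have y0 : 0 <= 1 - (2 * k%:R)^-1 :> R.
  by rewrite subr_ge0 invf_le1 ?mulr_gt0// -natrM ler1n muln_gt0.
have : (1 - (2 * k%:R)^-1) ^+ k < x ^+ k.
  by rewrite ltrXn2r ?nnegrE// -?lt0n.
move/lt_le_trans => /(_ _ xk); apply/negP; rewrite -leNgt.
have bern m : (1 - m%:R * (2 * k%:R)^-1) <= (1 - (2 * k%:R)^-1) ^+ m :> R.
  elim: m => [|m IH]; first by rewrite mul0r subr0 expr0.
  rewrite exprS; apply: (@le_trans _ _ ((1 - (2 * k%:R)^-1) * (1 - m%:R * (2 * k%:R)^-1))).
    have z0 : 0 <= (2 * k%:R)^-1 :> R by rewrite invr_ge0 mulr_ge0.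
    move: ((2 * k%:R)^-1) z0 => z z0; rewrite -natr1.
    have : 0 <= m%:R * z * z by rewrite !mulr_ge0.
    lra.
  exact: ler_wpM2l.
apply: le_trans (bern k); rewrite invfM mulrCA mulfV ?gt_eqF// mulr1; lra.
Qed.

Lemma spectral_radius_lt1 n (M : 'M[R]_n) k : (0 < k)%N ->
  (forall i j, n%:R * `|(M ^+ k) i j| <= 2^-1) -> spectral_radius_real M < 1.
Proof.
move=> k0 Mk; have k0' : 0 < (2 * k%:R)^-1 :> R by rewrite invr_gt0 mulr_gt0// ltr0n.
apply: (@le_lt_trans _ _ (1 - (2 * k%:R)^-1)); last by rewrite ltrBlDr ltrDl.
apply: spectral_radius_real_le => [|l el].
  by rewrite subr_ge0 invf_le1 ?mulr_gt0 ?ltr0n// -natrM ler1n muln_gt0.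
apply: bernoulli_half => //; first exact: nrm_ge0.
case: n M Mk el => [|n] M Mk el.
  by have := real_eigenvalue_pow_bound (k := k) (K := 0) el; rewrite mul0r;
    move=> /(_ ltac:(by case)) /le_trans; apply; rewrite invr_ge0.
apply: le_trans (real_eigenvalue_pow_bound (k := k) (K := n.+1%:R^-1 * 2^-1) el _) _.
  by move=> i j; rewrite ler_pdivlMl// Mk.
by rewrite mulrA mulfV// mul1r.
Qed.

Lemma unbounded_pow (x B : R) : 1 < x -> exists2 m, (0 < m)%N & B < x ^+ m.
Proof.
move=> x1.
have bern m : 1 + m%:R * (x - 1) <= x ^+ m.
  elim: m => [|m IH]; first by rewrite mul0r addr0 expr0.
  rewrite exprS; apply: (@le_trans _ _ (x * (1 + m%:R * (x - 1)))).
    have : 0 <= m%:R * (x - 1) * (x - 1) by rewrite !mulr_ge0// subr_ge0 ltW.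
    rewrite -natr1; lra.
  by rewrite ler_wpM2l// (le_trans ler01)// ltW.
have x10 : 0 < x - 1 by rewrite subr_gt0.
exists (Num.bound `|B / (x - 1)|).+1 => //; apply: lt_le_trans (bern _).
apply: (@lt_trans _ _ ((Num.bound `|B / (x - 1)|)%:R * (x - 1))).
  by rewrite -ltr_pdivrMr// (le_lt_trans (ler_norm _) (archi_boundP (normr_ge0 _))).
rewrite -natr1; lra.
Qed.

Lemma spectral_radius_le1 n (M : 'M[R]_n) (K : R) :
  (forall k i j, `|(M ^+ k) i j| <= K) -> spectral_radius_real M <= 1.
Proof.
move=> MK; apply: spectral_radius_real_le => // l el.
rewrite leNgt; apply/negP => l1.
have hb : forall k, cnorm l ^+ k <= n%:R * K.
  by move=> k; exact: real_eigenvalue_pow_bound el (MK k).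
have [m _] := unbounded_pow (n%:R * K) l1.
by rewrite ltNge hb.
Qed.

Lemma nneg_mx_pow_ge0 n (M : 'M[R]_n) k :
  (forall i j, 0 <= M i j) -> forall i j, 0 <= (M ^+ k) i j.
Proof.
move=> M0; elim: k => [|k IH] i j; first by rewrite expr0 mxE ler0n.
by rewrite exprS -mulmxE mxE sumr_ge0// => l _; rewrite mulr_ge0.
Qed.

Lemma nneg_mx_pow_le n (A B : 'M[R]_n) k :
  (forall i j, 0 <= A i j <= B i j) ->
  forall i j, (A ^+ k) i j <= (B ^+ k) i j.
Proof.
move=> AB; have A0 i j : 0 <= A i j by have /andP[] := AB i j.
elim: k => [|k IH] i j; first by rewrite !expr0.
rewrite !exprS -!mulmxE !mxE ler_sum// => l _.
by rewrite ler_pM ?nneg_mx_pow_ge0//; have /andP[] := AB i l.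
Qed.

(** If a diagonal entry of a power exceeded 1, its own powers would force
    exponential growth. *)
Lemma nneg_mx_pow_diag_le1 n (M : 'M[R]_n) (K : R) :
  (forall i j, 0 <= M i j) -> (forall k i j, (M ^+ k) i j <= K) ->
  forall k i, (M ^+ k) i i <= 1.
Proof.
move=> M0 MK k i; rewrite leNgt; apply/negP.
have Mpow m : ((M ^+ k) i i) ^+ m <= (M ^+ (k * m)) i i.
  elim: m => [|m IH]; first by rewrite muln0 !expr0 mxE eqxx.
  rewrite mulnS exprD exprS -mulmxE mxE (bigD1 i)//=.
  apply: (@le_trans _ _ ((M ^+ k) i i * (M ^+ (k * m)) i i)).
    by rewrite ler_wpM2l// nneg_mx_pow_ge0.
  by rewrite lerDl sumr_ge0// => l _; rewrite mulr_ge0// nneg_mx_pow_ge0.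
move=> /(unbounded_pow K)[m _]; apply/negP; rewrite -leNgt.
exact: le_trans (Mpow m) (MK _ _ _).
Qed.

Lemma decay_half n (q K : R) : 0 <= q < 1 -> 0 <= K ->
  exists2 k, (0 < k)%N & n%:R * (K * q ^+ k) <= 2^-1.
Proof.
move=> /andP[q0 q1] K0.
case: (eqVneq q 0) => [->|qn0].
  by exists 1%N => //; rewrite expr1 !mulr0 invr_ge0.
have q0' : 0 < q by rewrite lt_def qn0.
have [|m m0 hm] := @unbounded_pow q^-1 (2 * (n%:R * K)).
  by rewrite invf_gt1.
exists m => //; move: hm; rewrite exprVn.
rewrite -[X in _ < X]mul1r ltr_pdivlMr ?exprn_gt0// => /ltW hm.
by rewrite -[2^-1]mulr1 ler_pdivlMl//; move: hm; rewrite !mulrA.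
Qed.

(** Decay of powers passes to entrywise smaller nonnegative matrices, which
    replaces the Perron-Frobenius theorem. *)
Lemma nneg_spectral_radius_lt1_le n (A B : 'M[R]_n) :
  (forall i j, 0 <= A i j <= B i j) ->
  spectral_radius_real B < 1 -> spectral_radius_real A < 1.
Proof.
move=> AB /spectral_radius_pow_decay[q [K [q01 K0 BK]]].
have [k k0 hk] := decay_half n q01 K0.
apply: (spectral_radius_lt1 k0) => i j; apply: le_trans hk.
rewrite ler_wpM2l// (le_trans _ (BK k i j))// !ger0_norm ?nneg_mx_pow_le ?nneg_mx_pow_ge0//.
- by move=> a b; have /andP[/le_trans] := AB a b; apply.
- by move=> a b; have /andP[] := AB a b.
Qed.

End RealMatrices.

(** * Sums of nonnegative families *)

Section Sums.
Context {R : realType}.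
Local Open Scope ereal_scope.

Lemma esum_subset (T : choiceType) (A B : set T) (F : T -> \bar R) :
  A `<=` B -> (forall x, B x -> 0 <= F x) ->
  \esum_(x in A) F x <= \esum_(x in B) F x.
Proof.
move=> AB F0; rewrite (esumID A B)//; have -> : B `&` A = A by exact/setIidr.
by rewrite leeDl// esum_ge0// => x [/F0].
Qed.

(** Comparison along a map onto [A] that need not be injective: it suffices to
    dominate each term by the term of one preimage. *)
Lemma esum_le_cover (T T' : choiceType) (A : set T) (B : set T')
    (F : T -> \bar R) (G : T' -> \bar R) (j : T' -> T) :
  (forall x, A x -> exists y, [/\ B y, j y = x & F x <= G y]) ->
  (forall y, B y -> 0 <= G y) ->
  \esum_(x in A) F x <= \esum_(y in B) G y.
Proof.
move=> cov G0.
have [->|/set0P[x0 Ax0]] := eqVneq A set0.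
  by rewrite esum_set0 esum_ge0.
have [y0 _] := cov _ Ax0.
pose i x := xget y0 [set y | [/\ B y, j y = x & F x <= G y]].
have iP x : A x -> [/\ B (i x), j (i x) = x & F x <= G (i x)].
  by move=> /cov[y yP]; rewrite /i; case: xgetP => // /(_ y).
apply: (@le_trans _ _ (\esum_(x in A) G (i x))).
  by apply: le_esum => x /iP[].
rewrite -(@esum_image _ _ _ A i G).
  by apply: esum_subset => // y [x /iP[Bi _ _] <-].
move=> x y /set_mem /iP[_ jx _] /set_mem /iP[_ jy _] e.
by rewrite -jx e jy.
Qed.

Lemma esum_le_inj (T T' : choiceType) (A : set T) (B : set T')
    (F : T -> \bar R) (G : T' -> \bar R) (i : T -> T') :
  (forall x, A x -> B (i x)) ->
  (forall x y, A x -> A y -> i x = i y -> x = y) ->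
  (forall x, A x -> F x <= G (i x)) -> (forall y, B y -> 0 <= G y) ->
  \esum_(x in A) F x <= \esum_(y in B) G y.
Proof.
move=> AB inj FG G0; apply: (@le_trans _ _ (\esum_(x in A) G (i x))).
  exact: le_esum.
rewrite -(@esum_image _ _ _ A i G).
  by apply: esum_subset => // y [x /AB Bi <-].
by move=> x y /set_mem Ax /set_mem Ay; exact: inj.
Qed.

Lemma esum_fintype (I : finType) (a : I -> \bar R) : (forall i, 0 <= a i) ->
  \esum_(i in [set: I]) a i = \sum_i a i.
Proof.
have fI : finite_set [set: I] by exact: finite_finset.
move=> a0; rewrite esum_fset// [RHS](fsbig_seq _ _ (index_enum_uniq I)).
congr (\sum_(i \in _) _); apply/seteqP; split=> i _ //=.
exact: mem_index_enum.
Qed.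

Lemma esum_lty_sup (T : choiceType) (A : set T) (F : T -> \bar R) (b : R) :
  (forall X : set T, finite_set X -> X `<=` A -> \sum_(x \in X) F x <= b%:E) ->
  \esum_(x in A) F x <= b%:E.
Proof. by move=> h; apply: ge_ereal_sup => _ [X [fX XA] <-]; exact: h. Qed.

Lemma esumZ_le (T : choiceType) (A : set T) (F : T -> \bar R) (c : R) :
  (0 <= c)%R -> (forall x, A x -> 0 <= F x) ->
  \esum_(x in A) (c%:E * F x) <= c%:E * \esum_(x in A) F x.
Proof.
move=> c0 F0; apply: ge_ereal_sup => _ [X [fX XA] <-].
rewrite fsbig_finite//= big_seq -ge0_sume_distrr -?big_seq -?fsbig_finite//=; last first.
  by move=> x; rewrite in_fset_set// => /set_mem /XA; exact: F0.
by rewrite lee_wpmul2l// ?lee_fin//; apply: ereal_sup_ubound; exists X.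
Qed.

Lemma esumZ (T : choiceType) (A : set T) (F : T -> \bar R) (c : R) :
  (0 <= c)%R -> (forall x, A x -> 0 <= F x) ->
  \esum_(x in A) (c%:E * F x) = c%:E * \esum_(x in A) F x.
Proof.
move=> c0 F0; apply/eqP; rewrite eq_le esumZ_le//=.
have [->|cn0] := eqVneq c 0%R.
  by rewrite mul0e; apply: esum_ge0 => x Ax; rewrite mul0e.
have c0' : (0 < c)%R by rewrite lt_def cn0.
rewrite -lee_pdivlMl//.
apply: le_trans (esumZ_le _ _); last 2 first.
- by rewrite invr_ge0.
- by move=> x Ax; rewrite mule_ge0 ?lee_fin ?F0.
by apply: le_esum => x Ax; rewrite muleA -EFinM mulVf// mul1e.
Qed.

Lemma esum_prod (T T' : choiceType) (A : set T) (B : set T')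
    (F : T -> R) (G : T' -> R) (a b : R) :
  (forall x, A x -> 0 <= F x)%R -> (forall y, B y -> 0 <= G y)%R ->
  \esum_(x in A) (F x)%:E = a%:E -> \esum_(y in B) (G y)%:E = b%:E ->
  \esum_(p in A `*` B) (F p.1 * G p.2)%:E = (a * b)%:E.
Proof.
move=> F0 G0 Aa Bb.
rewrite -(@esum_esum _ _ _ A (fun=> B) (fun x y => (F x * G y)%:E)); last first.
  by move=> x y Ax By; rewrite lee_fin mulr_ge0 ?F0 ?G0.
transitivity (\esum_(x in A) (b%:E * (F x)%:E)).
  apply: eq_esum => x Ax; under eq_esum do rewrite EFinM.
  by rewrite esumZ ?F0 ?Bb 1?muleC// => y By; rewrite lee_fin G0.
have b0 : (0 <= b)%R.
  by rewrite -lee_fin -Bb esum_ge0// => y By; rewrite lee_fin G0.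
by rewrite esumZ// ?Aa ?EFinM 1?muleC// => x Ax; rewrite lee_fin F0.
Qed.

Lemma esum_prod_lty (T T' : choiceType) (A : set T) (B : set T')
    (F : T -> R) (G : T' -> R) :
  (forall x, A x -> 0 <= F x)%R -> (forall y, B y -> 0 <= G y)%R ->
  \esum_(x in A) (F x)%:E < +oo -> \esum_(y in B) (G y)%:E < +oo ->
  \esum_(p in A `*` B) (F p.1 * G p.2)%:E < +oo.
Proof.
move=> F0 G0 Aa Bb.
have fA : \esum_(x in A) (F x)%:E \is a fin_num.
  by rewrite ge0_fin_numE// esum_ge0// => x Ax; rewrite lee_fin F0.
have fB : \esum_(x in B) (G x)%:E \is a fin_num.
  by rewrite ge0_fin_numE// esum_ge0// => x Ax; rewrite lee_fin G0.
by rewrite (@esum_prod _ _ _ _ _ _ _ _ F0 G0 (esym (fineK fA)) (esym (fineK fB))) ltry.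
Qed.

Lemma esumZ_lty (T : choiceType) (A : set T) (F : T -> R) (c : R) :
  (0 <= c)%R -> (forall x, A x -> 0 <= F x)%R ->
  \esum_(x in A) (F x)%:E < +oo -> \esum_(x in A) (c * F x)%:E < +oo.
Proof.
move=> c0 F0 Foo; under eq_esum do rewrite EFinM.
rewrite esumZ//; exact: lte_mul_pinfty.
Qed.

(** Applied to a convergent Poincare series this replaces proper discontinuity:
    a ball contains finitely many orbit points. *)
Lemma esum_finite_level (T : choiceType) (A : set T) (F : T -> R) (c : R) :
  (0 < c)%R -> (forall x, A x -> c <= F x)%R ->
  \esum_(x in A) (F x)%:E < +oo -> finite_set A.
Proof.
move=> c0 cF Foo; apply: contrapT => infA.
have F0 x : A x -> (0 <= F x)%R by move=> /cF; apply: le_trans; exact: ltW.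
have fA : \esum_(x in A) (F x)%:E \is a fin_num.
  by rewrite ge0_fin_numE// esum_ge0// => x Ax; rewrite lee_fin F0.
pose n := (Num.bound `|fine (\esum_(x in A) (F x)%:E) / c|)%R.
have [X XA Xn] := infinite_set_fset n infA.
have : \esum_(x in [set` X]) (F x)%:E <= \esum_(x in A) (F x)%:E.
  by apply: esum_subset => // x Ax; rewrite lee_fin F0.
rewrite esum_fset//; last by move=> x /set_mem /XA Ax; rewrite lee_fin F0.
rewrite fsbig_finite//= set_fsetK sumEFin -(fineK fA) lee_fin => h.
have : (n%:R * c <= fine (\esum_(x in A) (F x)%:E))%R.
  apply: le_trans h; apply: (@le_trans _ _ (\sum_(i <- X) c)%R).
    by rewrite big_const_seq count_predT iter_addr_0 -[leRHS]mulr_natl ler_wpM2r ?ler_nat // ltW.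
  rewrite !big_seq; apply: ler_sum => x xX; apply: cF; exact: XA.
apply/negP; rewrite -ltNge -ltr_pdivrMr//.
exact: le_lt_trans (ler_norm _) (archi_boundP (normr_ge0 _)).
Qed.

Lemma esum_geometric_lty (a : R) (q : R) : (0 <= a)%R -> (0 <= q < 1)%R ->
  \esum_(n in [set: nat]) (a * q ^+ n)%:E < +oo.
Proof.
move=> a0 /andP[q0 q1].
rewrite -nneseries_esumT => [|n]; last by rewrite lee_fin mulr_ge0// exprn_ge0.
apply: (@le_lt_trans _ _ (a / (1 - q))%:E); last exact: ltry.
apply: lime_le.
  by apply: is_cvg_nneseries => n _ _; rewrite lee_fin mulr_ge0// exprn_ge0.
apply: nearW => n; rewrite sumEFin lee_fin -mulr_sumr ler_wpM2l//.
rewrite -[leRHS]mul1r ler_pdivlMr ?subr_gt0//.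
suff -> : ((\sum_(0 <= i < n) q ^+ i) * (1 - q) = 1 - q ^+ n)%R.
  by rewrite gerBl exprn_ge0.
elim: n => [|n IH]; first by rewrite big_nil mul0r expr0 subrr.
rewrite big_nat_recr//= mulrDl IH exprSr; ring.
Qed.

Lemma sum_lty (I : Type) (r : seq I) (P : pred I) (F : I -> \bar R) :
  (forall i, P i -> F i < +oo) -> \sum_(i <- r | P i) F i < +oo.
Proof.
move=> h; elim/big_ind : _ => //.
by move=> x y; exact: lte_add_pinfty.
Qed.
End Sums.

(** * Reduced words and paths in the Bass-Serre tree *)

Section Trees.
Context {V E : Type} (Y : sgraph V E).

Lemma walk_cat x y z p q :
  walk Y x p y -> walk Y y q z -> walk Y x (p ++ q) z.
Proof. by elim: p x => [x <-|e p IH x [<- /IH h] /h]. Qed.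

Definition rev_walk (p : seq E) := rev (map (erev Y) p).

Lemma rev_walkP x p y : walk Y x p y -> walk Y y (rev_walk p) x.
Proof.
elim: p x => [x ->//|e p IH x [<- /IH h]].
rewrite /rev_walk map_cons rev_cons -cats1; apply: walk_cat h _ => /=.
by split; rewrite /term// erevK.
Qed.

(** Two reduced walks to the same vertex whose first edges differ close up to a
    reduced loop, which a tree does not have. *)
Lemma reduced_revcat p q : reduced Y p -> reduced Y q ->
  (if p is e :: _ then (if q is f :: _ then f <> e else True) else True) ->
  reduced Y (rev_walk p ++ q).
Proof.
elim: p q => [//|e p IH] q [ep rp] rq qe.
rewrite /rev_walk map_cons rev_cons cat_rcons; apply: IH => //.
  by split=> //; case: q qe rq => // f q; rewrite erevK.
by case: p ep {rp} => // f p + /esym; apply.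
Qed.

Lemma reduced_walk_exists x p y : walk Y x p y ->
  exists2 q, walk Y x q y & reduced Y q.
Proof.
elim: p x => [x <-|e p IH x [ex /IH[q wq rq]]]; first by exists [::].
case: q wq rq => [|f q] wq rq; first by exists [:: e]; split.
have [fe|fe] := pselect (f = erev Y e); last by exists (e :: f :: q).
case: wq rq => _ + [_ rq]; rewrite fe /term erevK ex => wq.
by exists q.
Qed.

Lemma reduced_walk_unique x y p q : is_tree Y ->
  walk Y x p y -> walk Y x q y -> reduced Y p -> reduced Y q -> p = q.
Proof.
move=> [_ noloop]; elim: p x q => [|e p IH] x [|f q] //.
- by move=> <- wq _ rq; rewrite (noloop _ _ wq rq).
- by move=> wp xy rp _; rewrite -xy in wp; rewrite (noloop _ _ wp rp).
move=> wp wq rp rq; have [ef|ef] := pselect (f = e).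
  by subst f; congr cons; apply: (IH (term Y e)); [case: wp|case: wq|case: rp|case: rq].
have := noloop _ _ (walk_cat (rev_walkP wp) wq) (reduced_revcat rp rq ef).
by move/(congr1 size); rewrite size_cat addnC.
Qed.
End Trees.

Section BassSerre.
Context {R : realType} {X : metricType R} {H : set (isom X)}.
Hypothesis hH : subgroup H.
Variable D : graph_of_groups H.
Variable m : edge D -> set (isom X) -> isom X.
Hypothesis mP : forall f c, ecosets f c -> c (m f c).
Local Notation allowedD := (@allowed _ _ _ D).
Local Notation letter := (edge D * set (isom X))%type.
Implicit Types (e f : edge D) (v u : vert D) (w : seq letter).

Let H1 : H 1%g. Proof. by case: hH. Qed.
Let HM g h : H g -> H h -> H (g * h)%g. Proof. by case: hH => _ + _; apply. Qed.
Let HV g : H g -> H (g^-1)%g. Proof. by case: hH => _ _; apply. Qed.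

Let aVM g h (Hg : H g) (Hh : H h) a : actV D (g * h)%g a = actV D g (actV D h a).
Proof. exact: actVM. Qed.
Let aEM g h (Hg : H g) (Hh : H h) a : actE D (g * h)%g a = actE D g (actE D h a).
Proof. exact: actEM. Qed.

Lemma actVK g : H g -> cancel (actV D g) (actV D g^-1%g).
Proof. by move=> Hg a; rewrite -(aVM (HV Hg) Hg) mulVg actV1. Qed.
Lemma actEK g : H g -> cancel (actE D g) (actE D g^-1%g).
Proof. by move=> Hg a; rewrite -(aEM (HV Hg) Hg) mulVg actE1. Qed.

Lemma subgroup_vgroup v : subgroup (vgroup v).
Proof.
split; first by split; rewrite ?actV1.
  by move=> x y [Hx xv] [Hy yv]; split; rewrite ?(aVM Hx Hy) ?yv//; exact: HM.
by move=> x [Hx xv]; split; [exact: HV|rewrite -{1}xv actVK].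
Qed.

Lemma egroup_sub f : egroup f `<=` vgroup (orig (graph D) f).
Proof.
by move=> g [Hg gf]; split=> //; rewrite -liftE_orig -act_orig// gf.
Qed.

(** A coset of the edge group is the same thing as an edge of the tree at the
    lifted vertex; this is how letters are read off a path in the tree. *)
Lemma ecosetE f c r : ecosets f c -> c r ->
  c = [set x | H x /\ actE D x (liftE D f) = actE D r (liftE D f)].
Proof.
move=> [r0 [Hr0 _] <-] [k [Hk kf] <-].
apply/seteqP; split=> x.
  by move=> [k' [Hk' kf'] <-]; split; [exact: HM|rewrite (aEM Hr0 Hk) (aEM Hr0 Hk') kf kf'].
move=> [Hx xr]; exists (r0^-1 * x)%g; last by rewrite mulgA mulgV mul1g.
split; first by apply: HM => //; exact: HV.
by rewrite (aEM (HV Hr0) Hx) xr (aEM Hr0 Hk) kf actEK.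
Qed.

Lemma ecoset_vgroup f c r : ecosets f c -> c r -> vgroup (orig (graph D) f) r.
Proof.
move=> [r0 vr0 <-] [k /egroup_sub vk <-].
by have [_ vM _] := subgroup_vgroup (orig (graph D) f); exact: vM.
Qed.

Lemma ecoset_in f c r : ecosets f c -> c r -> H r.
Proof. by move=> fc /(ecoset_vgroup fc)[]. Qed.

(** Restricting the transitions to a set [F] covers at once the whole transition
    matrix, its blocks and their finite truncations. *)
Fixpoint fpath (F : set (transition D)) e w f : Prop :=
  if w is (g, c) :: w' then F (e, g, c) /\ fpath F g w' f else e = f.

(** Paths between vertices instead of states: no edge precedes the first letter,
    so its coset is unconstrained. *)
Definition rpath v w u : Prop :=
  if w is (f, c) :: w' then
    [/\ orig (graph D) f = v, ecosets f c &
        exists2 g, fpath allowedD f w' g & term (graph D) g = u]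
  else v = u.

Lemma fpath_rpath e w f :
  fpath allowedD e w f -> rpath (term (graph D) e) w (term (graph D) f).
Proof.
case: w => [->//|[g c] w [[eg gc _] wf]]; split=> //.
by exists f.
Qed.

Lemma rpath_cons v f c w u : rpath v ((f, c) :: w) u ->
  [/\ orig (graph D) f = v, ecosets f c & rpath (term (graph D) f) w u].
Proof. by move=> [fv fc [g wg <-]]; split=> //; exact: fpath_rpath. Qed.

Lemma coset_pathP e w : coset_path e w <->
  exists2 f, fpath allowedD e w f & term (graph D) f = base D.
Proof.
elim: w e => [|[f c] w IH] e /=; first by split=> [h|[f -> //]]; exists e.
rewrite IH; split=> [[a [g wg gb]]|[g [a wg] gb]]; first by exists g.
by split=> //; exists g.
Qed.

Lemma reduced_loopP w : reduced_loop w <-> rpath (base D) w (base D).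
Proof. by case: w => [//|[f c] w] /=; split=> -[? ? /coset_pathP]. Qed.

Definition word_elt w : isom X := (\prod_(fc <- w) (m fc.1 fc.2 * tau D fc.1))%g.

Lemma word_elt_nil : word_elt [::] = 1%g.
Proof. by rewrite /word_elt big_nil. Qed.
Lemma word_elt_cons f c w : word_elt ((f, c) :: w) = (m f c * tau D f * word_elt w)%g.
Proof. by rewrite /word_elt big_cons. Qed.

Lemma letter_in f c : ecosets f c -> H (m f c * tau D f)%g.
Proof. by move=> fc; apply: HM; [exact: (ecoset_in fc (mP fc))|exact: tau_in]. Qed.

Lemma word_elt_in v w u : rpath v w u -> H (word_elt w).
Proof.
elim: w v => [|[f c] w IH] v; first by rewrite word_elt_nil.
move=> /rpath_cons[_ fc /IH Hw]; rewrite word_elt_cons.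
exact: HM (letter_in fc) Hw.
Qed.

(** In the tree, where reducedness has a geometric meaning, a word becomes an
    edge path from the translate by [g] of the lift of its first vertex. *)
Fixpoint tpath g w : seq (tedge D) :=
  if w is (f, c) :: w' then
    actE D g (actE D (m f c) (liftE D f)) :: tpath (g * (m f c * tau D f))%g w'
  else [::].

Lemma tpath_walk g v w u : H g -> rpath v w u ->
  walk (tree D) (actV D g (liftV D v)) (tpath g w)
    (actV D (g * word_elt w)%g (liftV D u)).
Proof.
elim: w g v => [|[f c] w IH] g v Hg.
  by move=> /= ->; rewrite word_elt_nil mulg1.
move=> /rpath_cons[fv fc wu] /=; have Hb := letter_in fc.
have Hm := ecoset_in fc (mP fc); split.
  by have [_ hv] := ecoset_vgroup fc (mP fc); rewrite !act_orig// liftE_orig hv fv.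
rewrite word_elt_cons (mulgA g _ (word_elt w)).
suff -> : term (tree D) (actE D g (actE D (m f c) (liftE D f))) =
   actV D (g * (m f c * tau D f))%g (liftV D (term (graph D) f)).
  by apply: IH => //; exact: HM.
rewrite /term !act_rev// !act_orig// -/(term _ _) tau_term.
by rewrite (aVM Hg Hb) (aVM Hm (tau_in f)).
Qed.

(** Backtracking in the tree is exactly what an allowed transition forbids. *)
Lemma backtrackE f c f' c' : ecosets f c -> ecosets f' c' ->
  actE D (m f c * tau D f)%g (actE D (m f' c') (liftE D f')) =
    erev (tree D) (actE D (m f c) (liftE D f)) <->
  f' = erev (graph D) f /\ c' = egroup f'.
Proof.
move=> fc fc'; have Hm := ecoset_in fc (mP fc); have Hm' := ecoset_in fc' (mP fc').
have Ht := tau_in f.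
rewrite act_rev// (aEM Hm Ht); split; last first.
  move=> [ff' cE]; have := mP fc'; rewrite {1}cE => -[_ ->].
  by rewrite ff' liftE_rev -(aEM Ht (HV Ht)) mulgV actE1.
move=> /(can_inj (actEK Hm)) h.
have ff' : f' = erev (graph D) f.
  have := congr1 (projE D) h.
  rewrite proj_rev liftE_proj => <-.
  rewrite -{1}(liftE_proj f'); apply/projE_orbit.
  by exists (tau D f * m f' c')%g; [exact: HM|rewrite (aEM Ht Hm')].
split=> //.
have mf : actE D (m f' c') (liftE D f') = liftE D f'.
  by rewrite [in RHS]ff' liftE_rev -h actEK.
rewrite (ecosetE fc' (mP fc')) mf.
by apply/seteqP; split.
Qed.

Lemma tpath_reduced g v w u : H g -> rpath v w u -> reduced (tree D) (tpath g w).
Proof.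
elim: w g v => [//|[f c] w IH] g v Hg wu.
have [_ fc wu'] := rpath_cons wu; have Hb := letter_in fc.
split; last by apply: IH wu'; exact: HM.
case: w wu wu' {IH} => [//|[f' c'] w] /= [_ _ [? [[_ fc' nb] _] _]] _.
have Hm' := ecoset_in fc' (mP fc').
rewrite act_rev// (aEM Hg Hb).
move/(can_inj (actEK Hg)) => h.
by have [/nb] := (backtrackE fc fc').1 h.
Qed.

Lemma tpath_inj g v w w' u : H g -> rpath v w u -> rpath v w' u ->
  tpath g w = tpath g w' -> w = w'.
Proof.
elim: w g v w' => [|[f c] w IH] g v [|[f' c'] w']//= Hg.
move=> /rpath_cons[fv fc wu] /rpath_cons[fv' fc' wu'] [].
move/(can_inj (actEK Hg)) => h.
have Hm := ecoset_in fc (mP fc); have Hm' := ecoset_in fc' (mP fc').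
have ff' : f = f'.
  rewrite -(liftE_proj f) -(liftE_proj f'); apply/projE_orbit.
  exists ((m f' c')^-1 * m f c)%g; first by apply: HM => //; exact: HV.
  by rewrite (aEM (HV Hm') Hm) h actEK.
subst f'; have cc' : c = c'.
  by rewrite (ecosetE fc (mP fc)) (ecosetE fc' (mP fc')) h.
subst c' => t; rewrite (IH _ (term (graph D) f) w' _ wu wu' t)//.
by apply: HM => //; exact: letter_in.
Qed.

(** Uniqueness of normal forms: the tree has a single reduced path between the
    two vertices, and the word can be read off it. *)
Lemma word_elt_inj v w w' u k k' : rpath v w u -> rpath v w' u ->
  vgroup u k -> vgroup u k' ->
  (word_elt w * k = word_elt w' * k')%g -> w = w' /\ k = k'.
Proof.
move=> wu wu' [Hk ku] [Hk' ku'] e.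
have ww' : w = w'.
  apply: (@tpath_inj 1%g v w w' u) => //.
  have t1 := tpath_walk H1 wu; have t2 := tpath_walk H1 wu'.
  apply: (reduced_walk_unique (tree_is_tree D) t1) (tpath_reduced H1 wu) (tpath_reduced H1 wu').
  suff -> : actV D (1 * word_elt w)%g (liftV D u) = actV D (1 * word_elt w')%g (liftV D u) by [].
  rewrite !mul1g -[in LHS]ku -[in RHS]ku'.
  by rewrite -(aVM (word_elt_in wu) Hk) -(aVM (word_elt_in wu') Hk') e.
by split=> //; apply: (@mulgI _ (word_elt w)); rewrite e ww'.
Qed.

(** Existence of normal forms: the group element moving a lifted edge to the next
    edge of the path is determined up to the edge group, hence it determines a
    coset, and the chosen representative of that coset does as well. *)
Lemma tpath_surj g v q a : H g -> walk (tree D) (actV D g (liftV D v)) q a ->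
  reduced (tree D) q ->
  exists w, [/\ rpath v w (projV D a), tpath g w = q &
    actV D (g * word_elt w)%g (liftV D (projV D a)) = a].
Proof.
elim: q g v => [|e q IH] g v Hg.
  move=> /= <- _.
  have pv : projV D (actV D g (liftV D v)) = v.
    rewrite -[RHS]liftV_proj; apply/esym/projV_orbit; by exists g.
  by exists [::]; rewrite pv word_elt_nil mulg1.
move=> [eo wq] [eq rq].
pose f := projE D e.
have fv : orig (graph D) f = v.
  rewrite /f -proj_orig eo -[RHS]liftV_proj; apply/esym/projV_orbit.
  by exists g.
have [h Hh eh] : exists2 h, H h & actE D g^-1%g e = actE D h (liftE D f).
  apply/projE_orbit; rewrite liftE_proj; apply/projE_orbit.
  by exists g^-1%g; [exact: HV|].
have ge : e = actE D g (actE D h (liftE D f)).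
  by rewrite -eh -(aEM Hg (HV Hg)) mulgV actE1.
pose c := lcoset h (egroup f).
have fc : ecosets f c.
  exists h => //; split=> //.
  rewrite fv; apply: (can_inj (actVK Hg)).
  by rewrite -eo ge !act_orig// liftE_orig fv.
have me : actE D (m f c) (liftE D f) = actE D h (liftE D f).
  have ch : c h by exists 1%g; rewrite ?mulg1//; split; rewrite ?actE1.
  by have := mP fc; rewrite {1}(ecosetE fc ch) => -[].
have Hm := ecoset_in fc (mP fc).
have Hb := letter_in fc.
have Hgb : H (g * (m f c * tau D f))%g by exact: HM.
have [|w [wa wt wE]] := IH (g * (m f c * tau D f))%g (term (graph D) f) Hgb _ rq.
  suff <- : term (tree D) e = actV D (g * (m f c * tau D f))%g (liftV D (term (graph D) f)) by [].
  rewrite ge -me /term !act_rev// !act_orig// -/(term _ _) tau_term.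
  by rewrite (aVM Hg Hb) (aVM Hm (tau_in f)).
exists ((f, c) :: w); split; last by rewrite word_elt_cons (mulgA g _ (word_elt w)).
  split=> //; case: w wa wt {wE} => [|[f' c'] w] wa wt; first by exists f.
  case: wa => ff' fc' [g' wg' g'a]; exists g' => //; split=> //; split=> // f'f c'E.
  move: eq; rewrite -wt /=; apply; rewrite (aEM Hg Hb).
  rewrite ge -me act_rev//; congr (actE D g _).
  exact/(backtrackE fc fc').
by rewrite /= wt me -ge.
Qed.

Lemma normal_form_exists h : H h -> exists p, normal_form m h p.
Proof.
move=> Hh; have [conn _] := tree_is_tree D.
have [p wp] := conn (liftV D (base D)) (actV D h (liftV D (base D))).
have [q wq rq] := reduced_walk_exists wp.
have pb : projV D (actV D h (liftV D (base D))) = base D.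
  by rewrite -[RHS]liftV_proj; apply/esym/projV_orbit; exists h.
rewrite -[X in walk _ X _ _]actV1 in wq.
have [w [wb _ wE]] := tpath_surj H1 wq rq.
rewrite pb in wb wE.
have Hw := word_elt_in wb.
exists (w, (word_elt w)^-1 * h)%g; split=> /=.
- exact/reduced_loopP.
- split; first by apply: HM => //; exact: HV.
  by rewrite (aVM (HV Hw) Hh) -wE mul1g actVK.
- by rewrite -/(word_elt w) mulgA mulgV mul1g.
Qed.

Lemma normal_form_unique h p q : normal_form m h p -> normal_form m h q -> p = q.
Proof.
case: p q => [w k] [w' k'] [/= /reduced_loopP wl vk hE] [/= /reduced_loopP wl' vk' hE'].
by have [|-> ->] := word_elt_inj wl wl' vk vk'; first by rewrite /word_elt -hE -hE'.
Qed.

End BassSerre.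

(** * Path sums and powers of the transition matrix *)

Section PathSums.
Context {R : realType} {X : metricType R} {H : set (isom X)}.
Variable D : graph_of_groups H.
Variable o : X.
Local Notation letter := (edge D * set (isom X))%type.
Local Notation allowedD := (@allowed _ _ _ D).
Implicit Types (e f : edge D) (v u : vert D) (w : seq letter) (s : R)
  (F : set (transition D)) (C : {set edge D}).

Fixpoint trans e w : seq (transition D) :=
  if w is (g, c) :: w' then (e, g, c) :: trans g w' else [::].

Lemma fpathE F e w f :
  fpath F e w f <-> (forall t, t \in trans e w -> F t) /\ last e (map fst w) = f.
Proof.
elim: w e => [|[g c] w IH] e /=; first by split=> [|[]].
rewrite IH; split=> [[Ft [Fw wf]]|[Fw wf]].
  by split=> // t; rewrite inE => /predU1P[->//|]; exact: Fw.
split; first by apply: Fw; rewrite mem_head.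
by split=> // t tw; apply: Fw; rewrite inE tw orbT.
Qed.

Lemma fpath_sub F F' e w f : F `<=` F' -> fpath F e w f -> fpath F' e w f.
Proof. by move=> FF' /fpathE[Fw wf]; apply/fpathE; split=> // t /Fw /FF'. Qed.

Lemma fpath_cat F e p q f :
  fpath F e (p ++ q) f <-> exists2 g, fpath F e p g & fpath F g q f.
Proof.
elim: p e => [|[g c] p IH] e /=.
  by split=> [h|[g <-//]]; exists e.
rewrite IH; split=> [[Fe [a pa qa]]|[a [Fe pa] qa]]; first by exists a.
by split=> //; exists a.
Qed.

Definition word_len w : R := \sum_(fc <- w) edge_length o fc.1 fc.2.
Definition word_wt s w : R := expR (- s * word_len w).

Lemma edge_length_ge0 f c : 0 <= edge_length o f c.
Proof.
rewrite /edge_length; set S := [set _ | _ in _].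
have [->|/set0P S0] := eqVneq S set0; first by rewrite inf0.
by apply: lb_le_inf => // _ [g _ <-]; exact: mdist_ge0.
Qed.

Lemma edge_length_le f c g : c g -> edge_length o f c <= mdist o ((g * tau D f)%g o).
Proof.
move=> cg; apply: ge_inf; last by exists g.
by exists 0 => _ [k _ <-]; exact: mdist_ge0.
Qed.

Lemma wlen_nil : word_len [::] = 0. Proof. by rewrite /word_len big_nil. Qed.
Lemma wlen_cons f c w : word_len ((f, c) :: w) = edge_length o f c + word_len w.
Proof. by rewrite /word_len big_cons. Qed.
Lemma wlen_cat p q : word_len (p ++ q) = word_len p + word_len q.
Proof. by rewrite /word_len big_cat. Qed.
Lemma wlen_ge0 w : 0 <= word_len w.
Proof. by apply: sumr_ge0 => i _; exact: edge_length_ge0. Qed.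

Lemma wt_gt0 s w : 0 < word_wt s w. Proof. exact: expR_gt0. Qed.
Lemma wt_ge0 s w : 0 <= word_wt s w. Proof. exact: expR_ge0. Qed.
Lemma wt_nil s : word_wt s [::] = 1. Proof. by rewrite /word_wt wlen_nil mulr0 expR0. Qed.
Lemma wt_cat s p q : word_wt s (p ++ q) = word_wt s p * word_wt s q.
Proof. by rewrite /word_wt wlen_cat mulrDr expRD. Qed.
Lemma wt_cons s f c w :
  word_wt s ((f, c) :: w) = expR (- s * edge_length o f c) * word_wt s w.
Proof. by rewrite /word_wt wlen_cons mulrDr expRD. Qed.
Lemma wt1 s f c : word_wt s [:: (f, c)] = expR (- s * edge_length o f c).
Proof. by rewrite wt_cons wt_nil mulr1. Qed.
(** These are the entries of the [n]-th power of the transition matrix. *)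
Definition psum F s n e f : \bar R :=
  (\esum_(w in [set w | size w = n /\ fpath F e w f]) (word_wt s w)%:E)%E.

Lemma wtE_ge0 s w : (0 <= (word_wt s w)%:E)%E. Proof. by rewrite lee_fin wt_ge0. Qed.
Hint Resolve wtE_ge0 : core.

Lemma psum0 F s e : psum F s 0 e e = 1%:E.
Proof.
rewrite /psum; have -> : [set w | size w = 0 /\ fpath F e w e] = [set [::]].
  by apply/seteqP; split=> w; [case=> /size0nil|move=> ->].
by rewrite esum_set1 ?wt_nil.
Qed.

Lemma psum0_neq F s e f : e <> f -> psum F s 0 e f = 0%E.
Proof.
move=> ef; rewrite /psum; suff -> : [set w | size w = 0 /\ fpath F e w f] = set0.
  by rewrite esum_set0.
by apply/seteqP; split=> w //= -[/size0nil ->].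
Qed.

Lemma Kmat_on_ge0 F s e f : (0 <= Kmat_on o F s e f)%E.
Proof. by apply: esum_ge0 => c _; rewrite lee_fin expR_ge0. Qed.

Definition real_block C F s : 'M[R]_#|C| :=
  map_mx fine (block C (Kmat_on o F s)).

Definition finite_on C (M : edge D -> edge D -> \bar R) :=
  forall e f, e \in C -> f \in C -> M e f \is a fin_num.

Lemma psumE C F s n : F `<=` transitions_in C -> finite_on C (Kmat_on o F s) ->
  forall i j : 'I_#|C|,
  psum F s n (enum_val i) (enum_val j) = ((real_block C F s ^+ n) i j)%:E.
Proof.
move=> FC Kfin; elim: n => [|n IH] i j.
  rewrite expr0 mxE; case: eqVneq => [->|ij] /=; first exact: psum0.
  by rewrite psum0_neq// => /enum_val_inj /eqP; apply/negP.
rewrite exprS -mulmxE mxE /psum.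
pose A (k : 'I_#|C|) := [set c | F (enum_val i, enum_val k, c)].
pose B (k : 'I_#|C|) := [set w | size w = n /\ fpath F (enum_val k) w (enum_val j)].
pose e (p : 'I_#|C| * (set (isom X) * seq letter)) := (enum_val p.1, p.2.1) :: p.2.2.
rewrite (@reindex_esum _ _ _ ([set: 'I_#|C|] `*`` (fun k => A k `*` B k)) _ e); last first.
  split.
  - by move=> [k [c w]] /= [_ [Ac [<- Bw]]]; split.
  - by move=> [k [c w]] [k' [c' w']] _ _ [/enum_val_inj -> -> ->].
  - move=> [|[g c] w] /= [] // [nw] [Fg wj].
    have gC : g \in C by have [] := FC _ Fg.
    exists (enum_rank_in gC g, (c, w)); last by rewrite /e /= enum_rankK_in.
    by rewrite /= /A /B /= enum_rankK_in.
rewrite -(@esum_esum _ _ _ [set: 'I_#|C|] (fun k => A k `*` B k)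
  (fun k p => (word_wt s (e (k, p)))%:E)); last by [].
rewrite esum_fintype; last by move=> k; exact: esum_ge0.
rewrite -sumEFin; apply: eq_bigr => k _; rewrite /e /=.
under eq_esum do rewrite wt_cons.
rewrite (@esum_prod _ _ _ (A k) (B k) (fun c => expR (- s * edge_length o (enum_val k) c))
   (word_wt s) (real_block C F s i k) ((real_block C F s ^+ n) k j))//.
- by move=> c _; exact: expR_ge0.
- by rewrite !mxE fineK//; apply: Kfin; exact: enum_valP.
- exact: IH.
Qed.

Lemma real_block_ge0 C F s i j : 0 <= real_block C F s i j.
Proof. by rewrite !mxE fine_ge0// Kmat_on_ge0. Qed.

Lemma spectral_radius_block_lt1 C (M : edge D -> edge D -> \bar R) :
  (spectral_radius (block C M) < 1)%E <->
  finite_on C M /\ spectral_radius_real (map_mx fine (block C M)) < 1.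
Proof.
rewrite /spectral_radius; case: ifPn => [/forallP h|/forallPn[i /forallPn[j ij]]].
  rewrite lte_fin; split=> [|[]//] rho1; split=> // e f eC fC.
  have /forallP := h (enum_rank_in eC e); move=> /(_ (enum_rank_in fC f)).
  by rewrite mxE !enum_rankK_in.
split=> [//|[Mfin _]]; move: ij; rewrite mxE Mfin//; exact: enum_valP.
Qed.

Lemma spectral_radius_block_le C (M : edge D -> edge D -> \bar R) : finite_on C M ->
  spectral_radius (block C M) = (spectral_radius_real (map_mx fine (block C M)))%:E.
Proof.
move=> Mfin; rewrite /spectral_radius ifT//; apply/forallP => i; apply/forallP => j.
by rewrite mxE; apply: Mfin; exact: enum_valP.
Qed.

Lemma spectral_radius_block_mono C (M N : edge D -> edge D -> \bar R) :
  (forall e f, e \in C -> f \in C -> (0 <= M e f <= N e f)%E) ->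
  (spectral_radius (block C N) < 1)%E -> (spectral_radius (block C M) < 1)%E.
Proof.
move=> MN /spectral_radius_block_lt1[Nfin N1]; apply/spectral_radius_block_lt1.
have Mfin : finite_on C M.
  move=> e f eC fC; have /andP[M0 MleN] := MN _ _ eC fC.
  by rewrite ge0_fin_numE// (le_lt_trans MleN)// ltey_eq Nfin.
split; first exact: Mfin.
apply: (@nneg_spectral_radius_lt1_le _ _ _ (map_mx fine (block C N)) _ N1) => i j.
rewrite !mxE.
have /andP[M0 MleN] := MN _ _ (enum_valP i) (enum_valP j).
rewrite fine_ge0//= fine_le//; [apply: Mfin|apply: Nfin]; exact: enum_valP.
Qed.

Definition summable_paths s := forall e f, e \in trim D -> f \in trim D ->
  (\esum_(w in [set w | fpath allowedD e w f]) (word_wt s w)%:E < +oo)%E.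

Lemma summable_paths_Kmat s e f : summable_paths s -> e \in trim D -> f \in trim D ->
  (Kmat o s e f < +oo)%E.
Proof.
move=> Ps eT fT; apply: le_lt_trans (Ps e f eT fT).
apply: (@esum_le_inj _ _ _ _ _ _ _ (fun c => [:: (f, c)])) => //.
- by move=> c c' _ _ [].
- by move=> c _; rewrite wt1.
Qed.

(** If the sum over all paths converges then the powers of the transition
    matrix sum up, so some power is small. *)
Lemma summable_paths_spectral_radius C F s : C \subset trim D ->
  F `<=` transitions_in C -> summable_paths s ->
  (spectral_radius (block C (Kmat_on o F s)) < 1)%E.
Proof.
move=> /fintype.subsetP CT FC Ps; apply/spectral_radius_block_lt1.
have Fall : F `<=` allowedD by move=> t /FC[].
have Kfin : finite_on C (Kmat_on o F s).
  move=> e f eC fC; rewrite ge0_fin_numE ?Kmat_on_ge0//.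
  apply: le_lt_trans (summable_paths_Kmat Ps (CT _ eC) (CT _ fC)).
  apply: esum_subset => [c /Fall//|c _]; by rewrite lee_fin expR_ge0.
split=> //; rewrite -/(real_block C F s).
set M := real_block C F s.
have M0 k i j : 0 <= (M ^+ k) i j by apply: nneg_mx_pow_ge0; exact: real_block_ge0.
have bnd i j : exists B, forall N, \sum_(k < N) (M ^+ k) i j <= B.
  have := Ps _ _ (CT _ (enum_valP i)) (CT _ (enum_valP j)).
  set S := esum _ _ => Soo; have Sfin : S \is a fin_num.
    by rewrite ge0_fin_numE// esum_ge0.
  exists (fine S) => N; rewrite -lee_fin fineK// -sumEFin.
  under eq_bigr do rewrite -psumE//.
  rewrite -esum_fintype; last by move=> k; exact: esum_ge0.
  rewrite (@esum_esum _ _ _ [set: 'I_N] _ (fun k w => (word_wt s w)%:E))//.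
  apply: (@esum_le_inj _ _ _ _ _ _ _ snd) => //.
    by move=> [k w] [_ [_]]; exact: fpath_sub.
  move=> [k w] [k' w'] [_ /= [kw _]] [_ /= [kw' _]] ww'; subst w'; congr pair.
  by apply/val_inj; rewrite /= -kw.
have {bnd} [B bnd] : exists B, forall N, \sum_(k < N) \sum_i \sum_j (M ^+ k) i j <= B.
  pose b i j := projT1 (cid (bnd i j)).
  have bP i j : forall N, _ := projT2 (cid (bnd i j)).
  exists (\sum_i \sum_j b i j) => N.
  rewrite exchange_big/=; apply: ler_sum => i _.
  by rewrite exchange_big/=; apply: ler_sum => j _; exact: bP.
pose t k := \sum_i \sum_j (M ^+ k) i j.
have t0 k : 0 <= t k by apply: sumr_ge0 => i _; apply: sumr_ge0 => j _.
have Mt k i j : (M ^+ k) i j <= t k.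
  rewrite /t (bigD1 i)//= (bigD1 j)//= -addrA lerDl addr_ge0//.
    by apply: sumr_ge0.
  by apply: sumr_ge0 => l _; apply: sumr_ge0.
(* The terms t k have bounded partial sums, so one of them is small; k = 0 is
   excluded because the zeroth power says nothing about the matrix. *)
have [k k0 tk] : exists2 k, (0 < k)%N & #|C|%:R * t k <= 2^-1.
  apply: contrapT => nosmall.
  have big k : 2^-1 < #|C|%:R * t k.+1.
    rewrite ltNge; apply/negP => h; apply: nosmall; by exists k.+1.
  have sumbig N : N%:R / 2 <= #|C|%:R * \sum_(k < N.+1) t k.
    rewrite big_ord_recl mulrDr ler_wpDl ?mulr_ge0// mulr_sumr.
    rewrite mulr_natl -[N in leLHS]card_ord -sumr_const.
    apply: ler_sum => k _; apply: ltW; exact: (big k).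
  pose N := Num.bound `|2 * (#|C|%:R * B)|.
  have := le_trans (sumbig N) (ler_wpM2l (ler0n _ _) (bnd N.+1)).
  apply/negP; rewrite -ltNge ltr_pdivlMr// mulrC.
  exact: le_lt_trans (ler_norm _) (archi_boundP (normr_ge0 _)).
apply: (spectral_radius_lt1 k0) => i j; apply: le_trans tk.
by rewrite ler_wpM2l// ger0_norm.
Qed.

(** The powers of the block decay, whereas a closed path sum above 1 could be
    repeated. *)
Lemma psum_closed_le1 C F s n e : F `<=` transitions_in C -> e \in C ->
  (spectral_radius (block C (Kmat_on o F s)) < 1)%E -> (psum F s n e e <= 1)%E.
Proof.
move=> FC eC /spectral_radius_block_lt1[Kfin rho1].
have -> : e = enum_val (enum_rank_in eC e) by rewrite enum_rankK_in.
rewrite psumE// lee_fin.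
have [q [K [/andP[q0 q1] K0 MK]]] := spectral_radius_pow_decay rho1.
apply: (@nneg_mx_pow_diag_le1 _ _ _ K); first exact: real_block_ge0.
move=> k i j; apply: le_trans (ler_norm _) _; apply: le_trans (MK _ _ _) _.
by rewrite ler_piMr// exprn_ile1// ltW.
Qed.

End PathSums.

(** * Exponents and the orbit of the ambient group *)

Section InfPos.
Context {R : realType}.
Implicit Types (P Q : R -> Prop) (s : R).

Lemma inf_pos_lt P s : (inf_pos P < s%:E)%E -> exists s', [/\ 0 < s', s' < s & P s'].
Proof.
by move=> /ereal_inf_lt[_ [s' [s0 Ps'] <-]]; rewrite lte_fin => ss'; exists s'.
Qed.

Lemma inf_pos_le P s : 0 < s -> P s -> (inf_pos P <= s%:E)%E.
Proof. by move=> s0 Ps; apply: ereal_inf_lbound; exists s. Qed.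

Lemma inf_pos_ge P (a : \bar R) :
  (forall s, 0 < s -> P s -> (a <= s%:E)%E) -> (a <= inf_pos P)%E.
Proof. by move=> aP; apply: le_ereal_inf_tmp => _ [s [s0 Ps] <-]; exact: aP. Qed.

Lemma inf_pos_ge0 P : (0 <= inf_pos P)%E.
Proof. by apply: inf_pos_ge => s s0 _; rewrite lee_fin ltW. Qed.

Lemma inf_pos_mono P Q : (forall s, 0 < s -> P s -> Q s) ->
  (inf_pos Q <= inf_pos P)%E.
Proof. by move=> PQ; apply: inf_pos_ge => s s0 Ps; apply: inf_pos_le (PQ _ s0 Ps). Qed.

Lemma expR_weight_le (s s' d : R) : s <= s' -> 0 <= d ->
  expR (- s' * d) <= expR (- s * d).
Proof. by move=> ss' d0; rewrite ler_expR ler_wpM2r// lerN2. Qed.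
End InfPos.

Section Ambient.
Context {R : realType} {X : metricType R} {H : set (isom X)}.
Hypothesis hH : subgroup H.
Variable D : graph_of_groups H.
Variable o : X.
Local Notation letter := (edge D * set (isom X))%type.
Local Notation allowedD := (@allowed _ _ _ D).
Local Notation wlen := (@word_len _ _ _ D o).
Local Notation wt := (@word_wt _ _ _ D o).
Implicit Types (e f : edge D) (v u : vert D) (w : seq letter) (s : R)
  (F : set (transition D)) (C : {set edge D}).

Variables (Gam : set (isom X)) (delta : R).
Hypothesis HGam : H `<=` Gam.
Hypothesis hdelta : critical_exponent o Gam = delta%:E.

Lemma poincare_lty s : delta < s ->
  (\esum_(g in Gam) (expR (- s * mdist o (g o)))%:E < +oo)%E.
Proof.
move=> ds; have [|s' [s'0 s's Ps']] := @inf_pos_lt _ (fun s =>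
    (\esum_(g in Gam) (expR (- s * mdist o (g o)))%:E < +oo)%E) s.
  by rewrite [inf_pos _]hdelta lte_fin.
apply: le_lt_trans Ps'; apply: le_esum => g _.
by rewrite lee_fin expR_weight_le ?mdist_ge0// ltW.
Qed.

Lemma orbit_finite (r : R) : finite_set [set g | Gam g /\ mdist o (g o) <= r].
Proof.
have d1 : delta < `|delta| + 1 by rewrite (le_lt_trans (ler_norm _))// ltrDl.
have := poincare_lty d1; set s := `|delta| + 1 => Ps.
apply: (@esum_finite_level R (isom X) _ (fun g => expR (- s * mdist o (g o))) (expR (- s * r))).
- exact: expR_gt0.
- move=> g [_ gr]; rewrite ler_expR ler_wnM2l// oppr_le0 /s.
  by rewrite addr_ge0.
- apply: le_lt_trans Ps; apply: esum_subset => [g []//|g _].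
  by rewrite lee_fin expR_ge0.
Qed.

(** The minimum is attained because only finitely many elements of the ambient
    group displace the base point by a bounded amount. *)
Lemma minimizing_choice_exists :
  exists m : edge D -> set (isom X) -> isom X, minimizing_choice o m.
Proof.
suff /choice[m0 m0P] : forall fc : letter, exists g, ecosets fc.1 fc.2 ->
    fc.2 g /\ mdist o ((g * tau D fc.1)%g o) = edge_length o fc.1 fc.2.
  by exists (fun f c => m0 (f, c)) => f c; exact: (m0P (f, c)).
move=> [f c] /=; have [fc|nfc] := pselect (ecosets f c); last by exists 1%g.
have [r cr] : exists r, c r.
  case: fc => r _ <-; exists r, 1%g; last by rewrite mulg1.
  by split; rewrite ?actE1//; case: hH.
pose d (g : isom X) : R := mdist o ((g * tau D f)%g o).
pose A := [set g | c g /\ d g <= d r].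
have Afin : finite_set A.
  have := finite_image (fun g => g * (tau D f)^-1)%g (orbit_finite (d r)).
  apply: sub_finite_set => g [cg gr].
  exists (g * tau D f)%g; last by rewrite -mulgA mulgV mulg1.
  split=> //; apply: HGam; case: (hH) => _ HM _; apply: HM; last exact: (tau_in f).
  exact: (ecoset_in hH fc cg).
have [g [cg gr] gmin] : exists2 g, A g & forall k, A k -> d g <= d k.
  have Ar : r \in fset_set A by rewrite in_fset_set// inE.
  pose g := [arg min_(i < [` Ar]%fset) d (val i)]%O.
  exists (val g) => [|k Ak].
    by have := valP g; rewrite in_fset_set// inE.
  have Ak' : k \in fset_set A by rewrite in_fset_set// inE.
  by rewrite /g; case: arg_minP => // i _ /(_ [` Ak']%fset); apply.
exists g => _; split=> //; apply/eqP; rewrite eq_le edge_length_le// andbT.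
apply: lb_le_inf; first by exists (d r), r.
move=> _ [k ck <-]; have [kr|/ltW rk] := leP (d k) (d r); first exact: gmin.
exact: le_trans gr rk.
Qed.

Lemma word_elt_disp m v w u : minimizing_choice o m -> rpath v w u ->
  mdist o (word_elt m w o) <= wlen w.
Proof.
move=> mP; elim: w v => [|[f c] w IH] v.
  by rewrite word_elt_nil wlen_nil mdistxx.
move=> /(rpath_cons)[_ fc /IH h]; rewrite word_elt_cons wlen_cons.
have [_ <-] := mP f c fc.
apply: le_trans (metric_triangle _ ((m f c * tau D f)%g o) _) _.
by rewrite lerD2l (isom_dist (m f c * tau D f)%g o (word_elt m w o)).
Qed.

(** Distinct words with the same ends give distinct elements of the ambient
    group, and the length of a word bounds the displacement by its element. *)
Lemma path_sum_le_poincare s : 0 <= s -> forall e f,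
  (\esum_(w in [set w | fpath allowedD e w f]) (wt s w)%:E <=
   \esum_(g in Gam) (expR (- s * mdist o (g o)))%:E)%E.
Proof.
move=> s0 e f; have [m mP] := minimizing_choice_exists.
have mc f' c : ecosets f' c -> c (m f' c) by move=> /mP[].
have [V1 _ _] := subgroup_vgroup hH (term (graph D) f).
apply: (@esum_le_inj _ _ _ _ _ _ _ (word_elt m)).
- move=> w /= /fpath_rpath wp; apply: HGam; exact: (word_elt_in hH mc wp).
- move=> w w' /= /fpath_rpath wp /fpath_rpath wp' ww'.
  by have [|-> _] := word_elt_inj hH mc wp wp' V1 V1; first by rewrite ww'.
- move=> w /= /fpath_rpath wp; rewrite lee_fin ler_expR.
  by rewrite ler_wnM2l ?oppr_le0//; exact: word_elt_disp mP wp.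
- by move=> g _; rewrite lee_fin expR_ge0.
Qed.

Lemma summable_paths_gt s : 0 <= s -> delta < s -> @summable_paths _ _ _ D o s.
Proof.
move=> s0 ds e f _ _; apply: le_lt_trans (path_sum_le_poincare s0 e f) _.
exact: poincare_lty.
Qed.

(** Single letters may have length 0, but finitely many words have total length
    at most 1, since they give distinct elements of small displacement. *)
Lemma long_words : exists2 N, (0 < N)%N &
  forall e f w, fpath allowedD e w f -> (N <= size w)%N -> 1 <= wlen w.
Proof.
have [m mP] := minimizing_choice_exists.
have d1 : delta < `|delta| + 1 by rewrite (le_lt_trans (ler_norm _))// ltrDl.
have s0 : 0 <= `|delta| + 1 by rewrite addr_ge0.
set s := `|delta| + 1 in d1 s0.
have fin e f : exists N, forall w, fpath allowedD e w f -> wlen w <= 1 -> (size w < N)%N.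
  have Wfin : finite_set [set w | fpath allowedD e w f /\ wlen w <= 1].
    apply: (@esum_finite_level _ _ _ (wt s) (expR (- s * 1))).
    - exact: expR_gt0.
    - by move=> w [_ w1]; rewrite ler_expR ler_wnM2l// oppr_le0.
    - apply: le_lt_trans (le_lt_trans (path_sum_le_poincare s0 e f) (poincare_lty d1)).
      by apply: esum_subset => [w []//|w _]; exact: wtE_ge0.
  exists (\max_(w <- fset_set [set w | fpath allowedD e w f /\ wlen w <= 1]) size w).+1.
  move=> w we w1; rewrite ltnS.
  apply: (@leq_bigmax_seq _ _ _ (fun w : seq letter => size w) w) => //.
  by rewrite in_fset_set// inE.
pose N e f := projT1 (cid (fin e f)).
have NP e f := projT2 (cid (fin e f)) : forall w, _ -> _ -> (size w < N e f)%N.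
exists (\max_e \max_f N e f).+1 => // e f w wp wN; rewrite leNgt; apply/negP => /ltW w1.
have := NP e f w wp w1; apply/negP; rewrite -leqNgt; apply: leq_trans wN.
apply: leqW; apply: (@leq_trans (\max_f N e f)).
  exact: (leq_bigmax (F := N e) f).
exact: (leq_bigmax (F := fun e => \max_f N e f) e).
Qed.

Lemma wlen_ge_div : exists2 N, (0 < N)%N &
  forall e f w, fpath allowedD e w f -> (size w %/ N)%:R <= wlen w.
Proof.
have [N N0 NP] := long_words; exists N => // e f w wp.
suff h k : forall e w, fpath allowedD e w f -> (k * N <= size w)%N -> k%:R <= wlen w.
  by apply: h wp _; exact: leq_trunc_div.
elim: k => [|k IH] {w wp}e w wp kN; first exact: wlen_ge0.
move: wp; rewrite -(cat_take_drop N w) => /fpath_cat[g p1 p2].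
rewrite wlen_cat -natr1 addrC lerD//.
  apply: (NP _ _ _ p1); rewrite size_take; move: kN; rewrite mulSn; case: ifP => _; lia.
by apply: IH p2 _; rewrite size_drop; move: kN; rewrite mulSn; lia.
Qed.

End Ambient.

(** * Trimmed states and strongly connected components *)

Section Components.
Context {R : realType} {X : metricType R} {H : set (isom X)}.
Variable D : graph_of_groups H.
Variable o : X.
Local Notation letter := (edge D * set (isom X))%type.
Local Notation allowedD := (@allowed _ _ _ D).
Local Notation supp := (@Pilot.Defs.support _ _ _ D o).
Implicit Types (e f g : edge D) (v u : vert D) (w : seq letter) (s : R)
  (F : set (transition D)) (C : {set edge D}).

Lemma reduced_loop_trim w : reduced_loop w ->
  forall g, g \in map fst w -> g \in trim D.
Proof. by move=> lw g gw; rewrite inE; apply/asboolP; exists w. Qed.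

Lemma coset_path_cat e w f q :
  fpath allowedD e w f -> coset_path f q -> coset_path e (w ++ q).
Proof.
move=> wp /coset_pathP[g qp gb]; apply/coset_pathP; exists g => //.
by apply/fpath_cat; exists f.
Qed.

Lemma coset_path_split f w e : coset_path f w -> e \in map fst w ->
  exists p q, coset_path e q /\
    forall w', coset_path e w' -> coset_path f (p ++ w').
Proof.
elim: w f => [//|[g c] w IH] f /= [fg wg]; rewrite inE => /predU1P[->|ew].
  by exists [:: (g, c)], w.
have [p [q [eq ep]]] := IH _ wg ew; exists ((g, c) :: p), q; split=> // w' /ep.
by move=> h; split.
Qed.

(** A trimmed state is reached from the base vertex and returns to it, so any
    path between trimmed states extends to a loop. *)
Lemma trim_split e : e \in trim D ->
  exists p q, coset_path e q /\
    forall w', coset_path e w' -> reduced_loop (p ++ w').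
Proof.
rewrite inE => /asboolP[[|[f c] w]] //= [fb fc wf]; rewrite inE => /predU1P[->|ew].
  by exists [:: (f, c)], w.
have [p [q [eq pw]]] := coset_path_split wf ew.
exists ((f, c) :: p), q; split=> // w' /pw h; by split.
Qed.

Lemma trim_path e w f : e \in trim D -> f \in trim D -> fpath allowedD e w f ->
  forall g, g \in map fst w -> g \in trim D.
Proof.
move=> /trim_split[p [_ [_ pw]]] /trim_split[_ [q [fq _]]] wp g gw.
apply: (reduced_loop_trim (pw _ (coset_path_cat wp fq))).
by rewrite !map_cat !mem_cat gw orbT.
Qed.

Lemma supportP e f : reflect
  [/\ e \in trim D, f \in trim D & exists c, allowedD (e, f, c)] (supp e f).
Proof.
apply: (iffP and3P) => -[eT fT].
  move=> /asboolP[s _ /eqP Ks]; split=> //; apply: contrapT => nc; apply: Ks.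
  rewrite /Kmat /Kmat_on; set A := [set _ | _]; suff -> : A = set0 by rewrite esum_set0.
  by apply/seteqP; split=> c //= cA; apply: nc; exists c.
move=> [c ec]; split=> //; apply/asboolP; exists 1 => //.
rewrite gt_eqF//; apply: (@lt_le_trans _ _ (expR (- 1 * edge_length o f c))%:E).
  by rewrite lte_fin expR_gt0.
rewrite -(@esum_set1 _ _ c (fun c => (expR (- 1 * edge_length o f c))%:E)) ?lee_fin ?expR_ge0//.
by apply: esum_subset => [_ ->//|c' _]; rewrite lee_fin expR_ge0.
Qed.

Lemma fpath_support e w f : e \in trim D -> f \in trim D -> fpath allowedD e w f ->
  path supp e (map fst w).
Proof.
elim: w e => [//|[g c] w IH] e eT fT wp.
have gT : g \in trim D by apply: (trim_path eT fT wp); rewrite mem_head.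
case: wp => eg wp /=; apply/andP; split; last exact: IH.
by apply/supportP; split=> //; exists c.
Qed.

Lemma fpath_connect e w f : e \in trim D -> f \in trim D -> fpath allowedD e w f ->
  connect supp e f.
Proof.
move=> eT fT wp; apply/connectP; exists (map fst w); first exact: fpath_support wp.
by have [_ ->] := (fpathE _ _ _ _).1 wp.
Qed.

Lemma connect_fpath e f : connect supp e f -> exists w, fpath allowedD e w f.
Proof.
move=> /connectP[p + ->]; elim: p e => [|g p IH] e /=; first by exists [::].
by move=> /andP[/supportP[_ _ [c ec]] /IH[w wp]]; exists ((g, c) :: w).
Qed.

Definition component e : {set edge D} :=
  [set f in trim D | connect supp e f && connect supp f e].

Lemma trans_in_component e0 e w f : e \in trim D -> f \in trim D ->
  connect supp e0 e -> connect supp f e0 -> fpath allowedD e w f ->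
  forall t, t \in trans e w -> transitions_in (component e0) t.
Proof.
elim: w e => [//|[g c] w IH] e eT fT e0e fe0 wp t.
have gT : g \in trim D by apply: (trim_path eT fT wp); rewrite mem_head.
case: wp => eg wp /=.
have s_eg : supp e g by apply/supportP; split=> //; exists c.
have e0g := connect_trans e0e (connect1 s_eg).
have ge0 := connect_trans (fpath_connect gT fT wp) fe0.
rewrite inE => /predU1P[->|]; last by apply: IH wp t.
split=> //=; rewrite inE ?gT ?eT ?e0g ?e0e ?ge0//=.
exact: connect_trans (connect1 s_eg) ge0.
Qed.

Lemma componentsP C : C \in components D o ->
  exists2 e0, e0 \in trim D & C = component e0.
Proof.
by rewrite inE => /andP[/exists_inP[e eT /eqP ->] _]; exists e.
Qed.

Lemma component_sub C : C \in components D o -> C \subset trim D.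
Proof.
move=> /componentsP[e0 _ ->]; apply/fintype.subsetP => f; by rewrite inE => /andP[].
Qed.

Lemma component_fpath C e w f : C \in components D o -> e \in C -> f \in C ->
  fpath allowedD e w f -> fpath (transitions_in C) e w f.
Proof.
move=> /componentsP[e0 _ ->] /setIdP[eT /andP[e0e _]] /setIdP[fT /andP[_ fe0]] wp.
apply/fpathE; split; last by have [] := (fpathE _ _ _ _).1 wp.
exact: (trans_in_component eT fT e0e fe0 wp).
Qed.

Lemma component_connected C e f : C \in components D o -> e \in C -> f \in C ->
  exists w, fpath (transitions_in C) e w f.
Proof.
move=> CC eC fC; have [e0 _ CE] := componentsP CC.
have [w wp] : exists w, fpath allowedD e w f.
  apply: connect_fpath; move: eC fC; rewrite CE !inE => /andP[_ /andP[_ ee0]] /andP[_ /andP[e0f _]].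
  exact: connect_trans ee0 e0f.
by exists w; exact: component_fpath wp.
Qed.

Lemma closed_word_component e w : e \in trim D -> fpath allowedD e w e ->
  w <> [::] -> component e \in components D o /\ e \in component e.
Proof.
move=> eT wp w0; have eC : e \in component e by rewrite inE eT !connect0.
split=> //; rewrite inE; apply/andP; split.
  by apply/exists_inP; exists e.
apply/asboolP; have := fpath_support eT eT wp.
have := (fpathE _ _ _ _).1 wp => -[_ we].
have mw g : g \in map fst w -> g \in component e.
  have -> : map fst w = map (fun t : transition D => t.1.2) (trans e w).
    by elim: (w) (e) => // -[h c] w' IH e' /=; rewrite -IH.
  move=> /mapP[t tw ->].
  by have [] := trans_in_component eT eT (connect0 _ _) (connect0 _ _) wp tw.
have : map fst w <> [::] by case: (w) w0.
case/lastP: (map fst w) we mw => // p g; rewrite last_rcons => -> mw _ pe.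
exists (e :: p); split=> // f; rewrite inE => /predU1P[->//|fp].
by apply: mw; rewrite mem_rcons inE fp orbT.
Qed.

End Components.

(** * Convergence of sums over paths *)

Section ClosedPaths.
Context {R : realType} {X : metricType R} {H : set (isom X)}.
Variable D : graph_of_groups H.
Variable o : X.
Local Notation letter := (edge D * set (isom X))%type.
Local Notation allowedD := (@allowed _ _ _ D).
Local Notation wlen := (@word_len _ _ _ D o).
Local Notation wt := (@word_wt _ _ _ D o).
Local Notation summable_paths := (@summable_paths _ _ _ D o).
Implicit Types (e f g : edge D) (v u : vert D) (w : seq letter) (s : R)
  (F : set (transition D)) (C : {set edge D}).
Hint Resolve wtE_ge0 : core.


(** A closed path uses finitely many transitions, so a finite sum over closed
    paths is a path sum for some finite set of transitions. *)
Lemma psum_closed_le1_finite C s n e : C \in components D o -> e \in C ->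
  (forall F, finite_set F -> F `<=` transitions_in C ->
    (spectral_radius (block C (Kmat_on o F s)) < 1)%E) ->
  (psum o allowedD s n e e <= 1)%E.
Proof.
move=> CC eC rhoF; apply: esum_lty_sup => Y fY YW.
pose F := \bigcup_(w in Y) [set` trans e w].
have fF : finite_set F by apply: bigcup_finite => // w _; exact: finite_seq.
have FC : F `<=` transitions_in C.
  move=> t [w Yw tw]; have [_ wp] := YW _ Yw.
  by have [Tw _] := (fpathE _ _ _ _).1 (component_fpath CC eC eC wp); exact: Tw.
apply: le_trans (psum_closed_le1 n FC eC (rhoF _ fF FC)).
rewrite -esum_fset//; apply: esum_subset => // w Yw.
have [nw wp] := YW _ Yw; split=> //; apply/fpathE; split.
  by move=> t tw; exists w.
by have [] := (fpathE _ _ _ _).1 wp.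
Qed.

(** Raising the exponent turns bounded closed path sums into convergent ones,
    since long words have large total length. *)
Lemma closed_paths_lty s0 s e N : (0 < N)%N ->
  (forall e f w, fpath allowedD e w f -> (size w %/ N)%:R <= wlen w) ->
  s0 < s -> (forall n, (psum o allowedD s0 n e e <= 1)%E) ->
  (\esum_(w in [set w | fpath allowedD e w e]) (wt s w)%:E < +oo)%E.
Proof.
move=> N0 long s0s bnd.
have a0 : 0 < s - s0 by rewrite subr_gt0.
have N0' : 0 < N%:R :> R by rewrite ltr0n.
pose q := expR (- ((s - s0) / N%:R)).
have q01 : 0 <= q < 1.
  by rewrite expR_ge0 -expR0 ltr_expR oppr_lt0 divr_gt0.
(* The constant exp(s - s0) pays for the rounding in n %/ N >= n/N - 1. *)
apply: le_lt_trans (esum_geometric_lty (expR_ge0 (s - s0)) q01).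
have -> : [set w | fpath allowedD e w e] =
    \bigcup_(n in [set: nat]) [set w | size w = n /\ fpath allowedD e w e].
  by apply/seteqP; split=> [w wp|w [n _ []]//]; exists (size w).
rewrite esum_bigcupT//; last by move=> i j _ _ [w [[<- _] [<- _]]].
apply: le_esum => n _.
apply: (@le_trans _ _ ((expR (s - s0) * q ^+ n)%:E * psum o allowedD s0 n e e)%E).
  rewrite -esumZ ?mulr_ge0 ?expR_ge0 ?exprn_ge0//; last by case/andP: q01.
  apply: le_esum => w [nw wp]; rewrite -EFinM lee_fin /wt /q -expRM_natl -!expRD ler_expR.
  have := long _ _ _ wp; rewrite nw => nN.
  have : n%:R / N%:R - 1 <= wlen w.
    apply: le_trans nN; rewrite lerBlDr ler_pdivrMr// natr1 -natrM ler_nat ltnW//.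
    by rewrite mulnC; have := ltn_ceil n N0; rewrite mulnC.
  move=> nw'; have := ler_wpM2l (ltW a0) nw'.
  rewrite -/(wlen w) mulrBr mulr1 !mulrBl mulrA.
  set x := wlen w; move: (n%:R) (N%:R^-1) => y z; nra.
rewrite -[leRHS]mule1 lee_wpmul2l// lee_fin mulr_ge0 ?expR_ge0 ?exprn_ge0//.
by case/andP: q01.
Qed.

(** Only finitely many words are compared at a time, and each weight is
    continuous in the exponent. *)
Lemma psum_limit F (delta : R) n e f :
  (forall s, delta < s -> (psum o F s n e f <= 1)%E) ->
  (psum o F delta n e f <= 1)%E.
Proof.
move=> bnd; apply: esum_lty_sup => Y fY YW.
rewrite fsbig_finite//= sumEFin lee_fin leNgt; apply/negP => big.
set S := \sum_(w <- _) _ in big.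
pose L := \sum_(w <- fset_set Y) wlen w.
have L0 : 0 <= L by apply: sumr_ge0 => w _; exact: wlen_ge0.
have lnS : 0 < ln S by rewrite ln_gt0.
(* This close to delta the finitely many weights change by a factor less than
   S, the supposed value above 1; L + 1 avoids a division by zero. *)
pose s := delta + ln S / (2 * (L + 1)).
have L1 : 0 < 2 * (L + 1) by lra.
have ds : delta < s by rewrite ltrDl divr_gt0.
have : S <= expR ((s - delta) * L).
  have := bnd s ds; have : (\sum_(w \in Y) (wt s w)%:E <= psum o F s n e f)%E.
    by apply: ereal_sup_ubound; exists Y.
  move=> /le_trans h /h; rewrite fsbig_finite//= sumEFin lee_fin => Ss.
  rewrite -[leRHS]mulr1 -ler_pdivrMl ?expR_gt0//.
  apply: le_trans Ss; rewrite /S mulr_sumr !big_seq; apply: ler_sum => w wY.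
  rewrite -expRN /wt -expRD ler_expR.
  have wL : wlen w <= L.
    rewrite /L (big_rem w)//= lerDl; apply: sumr_ge0 => w' _; exact: wlen_ge0.
  have := ler_wpM2l (ltW _ : 0 <= s - delta) wL; rewrite subr_gt0 => /(_ ds).
  rewrite -/(wlen w); move: (wlen w) => x; lra.
rewrite -[X in X <= _](@lnK _ S) ?posrE ?(lt_trans _ big)// ler_expR.
rewrite /s addrC addKr mulrAC ler_pdivlMr//.
have := mulr_ge0 (ltW lnS) L0; nra.
Qed.


Lemma split_last_visit g h w f : fpath allowedD h w f -> g \notin map fst w \/
  exists w1 w2, [/\ w = w1 ++ w2, fpath allowedD h w1 g, fpath allowedD g w2 f
    & g \notin map fst w2].
Proof.
elim: w h => [|[k c] w IH] h; first by left.
move=> [hk wp]; case: (IH _ wp) => [gw|[w1 [w2 [wE p1 p2 gw2]]]].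
  have [gk|gk] := eqVneq g k.
    right; exists [:: (k, c)], w; split=> //; first by rewrite gk.
  by left; rewrite inE negb_or gk.
by right; exists ((k, c) :: w1), w2; rewrite wE.
Qed.

(** If the closed paths at each state have a finite sum, so do all paths:
    remove the states one at a time, splitting at the last visit. *)
Lemma summable_paths_of_closed s :
  (forall e f, e \in trim D -> f \in trim D -> (Kmat o s e f < +oo)%E) ->
  (forall e, e \in trim D ->
    (\esum_(w in [set w | fpath allowedD e w e]) (wt s w)%:E < +oo)%E) ->
  summable_paths s.
Proof.
move=> Kfin closed.
pose W (S : {set edge D}) e f :=
  [set w | fpath allowedD e w f /\ forall g, g \in map fst w -> g \in S].
suff WS : forall n (S : {set edge D}), #|S| = n -> S \subset trim D ->
    forall e f, e \in trim D -> f \in trim D ->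
    (\esum_(w in W S e f) (wt s w)%:E < +oo)%E.
  move=> e f eT fT; apply: le_lt_trans (WS _ (trim D) erefl (subxx _) e f eT fT).
  by apply: esum_subset => // w wp; split=> //; exact: trim_path wp.
elim=> [|n IH] S cS ST e f eT fT.
  apply: (@le_lt_trans _ _ (\esum_(w in [set [::] : seq letter]) (wt s w)%:E)%E).
    apply: esum_subset => // -[//|[g c] w] [_ /(_ g)].
    by rewrite mem_head => /(_ isT); rewrite (cards0_eq cS) inE.
  by rewrite esum_set1// ltry.
rewrite (esumID [set [::]])//; apply: lte_add_pinfty.
  apply: (@le_lt_trans _ _ (\esum_(w in [set [::] : seq letter]) (wt s w)%:E)%E).
    by apply: esum_subset => // w [].
  by rewrite esum_set1// ltry.
pose A g := [set c | allowedD (e, g, c)].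
pose B g := [set w | fpath allowedD g w g].
pose T := (edge D * (set (isom X) * (seq letter * seq letter)))%type.
pose wA g c := expR (- s * edge_length o g c).
pose wT (t : T) := wA t.1 t.2.1 * (wt s t.2.2.1 * wt s t.2.2.2).
apply: (@le_lt_trans _ _ (\esum_(g in [set g | g \in S])
    \esum_(p in A g `*` (B g `*` W (S :\ g) g f)) (wA g p.1 * (wt s p.2.1 * wt s p.2.2))%:E)%E).
  have wpos g p : (0 <= (wA g p.1 * (wt s p.2.1 * wt s p.2.2))%:E)%E.
    by rewrite lee_fin !mulr_ge0 ?expR_ge0.
  rewrite esum_esum//.
  apply: (@esum_le_cover _ _ _ _ _ _ _ (fun t : T => (t.1, t.2.1) :: t.2.2.1 ++ t.2.2.2)) => //.
  move=> [|[g c] w] [[wp wS] w0]; first by case: w0.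
  have gS : g \in S by apply: wS; rewrite mem_head.
  have wS' h : h \in map fst w -> h \in S by move=> hw; apply: wS; rewrite inE hw orbT.
  case: wp => ec wp.
  have [w1 [w2 [wE p1 p2 gw2]]] : exists w1 w2, [/\ w = w1 ++ w2,
      fpath allowedD g w1 g, fpath allowedD g w2 f & g \notin map fst w2].
    by case: (split_last_visit g wp) => // gw; exists [::], w.
  exists (g, (c, (w1, w2))); split => /=; last first.
  - by rewrite wt_cons wE wt_cat.
  - by rewrite wE.
  split=> //; split=> //; split=> //; split=> // h hw2; rewrite in_setD1.
  apply/andP; split; first by apply: contraNneq gw2 => <-.
  by apply: wS'; rewrite wE map_cat mem_cat hw2 orbT.
rewrite esum_fset//; last by move=> g _; apply: esum_ge0 => p _; rewrite lee_fin !mulr_ge0 ?expR_ge0.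
rewrite fsbig_finite//= big_seq; apply: sum_lty => g.
rewrite in_fset_set// inE => gS.
have gT : g \in trim D by move/fintype.subsetP: ST; exact.
apply: (@esum_prod_lty _ _ _ (A g) (B g `*` W (S :\ g) g f) (wA g)
  (fun p => wt s p.1 * wt s p.2)).
- by move=> c _; exact: expR_ge0.
- by move=> p _; rewrite mulr_ge0 ?expR_ge0.
- exact: Kfin.
apply: esum_prod_lty => [w _|w _||]; rewrite ?expR_ge0//; first exact: closed.
apply: IH => //; first by have := cardsD1 g S; rewrite gS cS => -[].
by apply: fintype.subset_trans ST; exact: subD1set.
Qed.

End ClosedPaths.

(** * The normal-form series and the blocks *)

Section NormalFormSums.
Context {R : realType} {X : metricType R} {H : set (isom X)}.
Hypothesis hH : subgroup H.
Variable D : graph_of_groups H.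
Variable o : X.
Variable m : edge D -> set (isom X) -> isom X.
Hypothesis mP : minimizing_choice o m.
Local Notation letter := (edge D * set (isom X))%type.
Local Notation allowedD := (@allowed _ _ _ D).
Local Notation wlen := (@word_len _ _ _ D o).
Local Notation wt := (@word_wt _ _ _ D o).
Local Notation summable_paths := (@summable_paths _ _ _ D o).
Implicit Types (e f g : edge D) (v u : vert D) (w : seq letter) (s : R)
  (F : set (transition D)) (C : {set edge D}).
Hint Resolve wtE_ge0 : core.

Let mc f c : ecosets f c -> c (m f c). Proof. by move=> /mP[]. Qed.

Definition BS_summable s :=
  (\esum_(h in H) (expR (- s * BS_length o m h))%:E < +oo)%E.

Definition coef_finite s :=
  [/\ (Vcoef D o s < +oo)%E,
    forall f, f \in trim D -> (ucoef o s f < +oo)%E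
    & forall e f, e \in trim D -> f \in trim D -> (Kmat o s e f < +oo)%E].

Lemma BS_lengthE w k : reduced_loop w -> vgroup (base D) k ->
  BS_length o m (word_elt m w * k)%g = wlen w + mdist o (k o).
Proof.
move=> lw vk; rewrite /BS_length.
have nf : normal_form m (word_elt m w * k)%g (w, k) by split.
case: xgetP => [p _ pP|/(_ (w, k))//].
by rewrite (normal_form_unique hH mc pP nf).
Qed.

Lemma loop_elt_in w k : reduced_loop w -> vgroup (base D) k -> H (word_elt m w * k)%g.
Proof.
move=> /reduced_loopP lw [Hk _]; case: (hH) => _ HM _; apply: HM => //.
exact: (word_elt_in hH mc lw).
Qed.

Lemma loop_elt_inj w w' k k' : reduced_loop w -> reduced_loop w' ->
  vgroup (base D) k -> vgroup (base D) k' ->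
  (word_elt m w * k = word_elt m w' * k')%g -> w = w' /\ k = k'.
Proof. by move=> /reduced_loopP lw /reduced_loopP lw'; exact: (word_elt_inj hH mc lw lw'). Qed.

Let vgroup1 : vgroup (base D) 1%g.
Proof. by have [] := subgroup_vgroup hH (base D). Qed.

Let expR_len0 (s r : R) : (0 <= (expR (- s * r))%:E)%E.
Proof. by rewrite lee_fin expR_ge0. Qed.
Hint Resolve expR_len0 : core.

(** Distinct loops are distinct elements of [H], so a family that injects into
    the loops is dominated by the normal-form series. *)
Lemma BS_summable_family (T : choiceType) (A : set T) (F : T -> R) (K : R) s
    (i : T -> seq letter) : BS_summable s -> 0 <= K ->
  (forall x, A x -> reduced_loop (i x)) ->
  (forall x y, A x -> A y -> i x = i y -> x = y) ->
  (forall x, A x -> F x <= K * wt s (i x)) ->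
  (\esum_(x in A) (F x)%:E < +oo)%E.
Proof.
move=> BS K0 loopi inji Fi.
apply: le_lt_trans (esumZ_lty K0 (fun h _ => expR_ge0 _) BS).
apply: (@esum_le_inj _ _ _ _ _ _ _ (fun x => word_elt m (i x) * 1)%g).
- by move=> x Ax; apply: loop_elt_in => //; exact: loopi.
- move=> x y Ax Ay /loop_elt_inj[]//; [exact: loopi|exact: loopi|].
  by move=> /inji e _; exact: e.
- move=> x Ax; rewrite lee_fin BS_lengthE//; last exact: loopi.
  by rewrite mdistxx addr0; exact: Fi.
- by move=> h _; rewrite lee_fin mulr_ge0// expR_ge0.
Qed.

Lemma cat_inj_r (T : Type) (p x y : seq T) : p ++ x = p ++ y -> x = y.
Proof. by elim: p => //= a p IH [/IH]. Qed.

Lemma cat_inj_l (T : eqType) (q x y : seq T) : x ++ q = y ++ q -> x = y.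
Proof.
move=> e; have := congr1 (take (size x)) e.
have sz : size x = size y.
  by move/(congr1 size): e; rewrite !size_cat => /addIn.
by rewrite take_size_cat// sz take_size_cat.
Qed.

Lemma wt_conj s p w q :
  wt s w = expR (s * (wlen p + wlen q)) * wt s (p ++ w ++ q).
Proof.
by rewrite /word_wt !wlen_cat -expRD; congr expR; ring.
Qed.

Lemma BS_summable_paths s : BS_summable s -> summable_paths s.
Proof.
move=> BS e f /trim_split[p [_ [_ pw]]] /trim_split[_ [q [fq _]]].
apply: (@BS_summable_family _ _ _ (expR (s * (wlen p + wlen q))) s
    (fun w => p ++ w ++ q)) => //.
- by move=> w wp; apply: pw; exact: coset_path_cat fq.
- by move=> w w' _ _ /cat_inj_r /cat_inj_l.
- by move=> w _; rewrite -wt_conj.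
Qed.

Lemma BS_summable_coef s : BS_summable s -> coef_finite s.
Proof.
move=> BS; split; last by move=> e f; exact: summable_paths_Kmat (BS_summable_paths BS).
  apply: le_lt_trans BS; apply: (@esum_le_inj _ _ _ _ _ _ _ (fun k => word_elt m [::] * k)%g) => //.
  - by move=> k vk; exact: loop_elt_in.
  - by move=> k k' vk vk' /loop_elt_inj[].
  - by move=> k vk; rewrite BS_lengthE// wlen_nil add0r.
move=> f fT; rewrite /ucoef; case: eqP => [fb|_]; last exact: ltry.
have [_ [q [fq _]]] := trim_split fT.
apply: (@BS_summable_family _ _ _ (expR (s * (wlen [::] + wlen q))) s
    (fun c => [:: (f, c)] ++ q)) => //.
- by move=> c c' _ _ [].
- by move=> c _; rewrite -[[:: (f, c)] ++ q]/([::] ++ [:: (f, c)] ++ q) -wt_conj wt1.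
Qed.

(** Conversely the normal form splits the series into the initial coset, a path
    between two states, and the vertex group. *)
Lemma coef_paths_BS_summable s : coef_finite s -> summable_paths s -> BS_summable s.
Proof.
move=> [Vfin ufin _] Ps.
have loops : (\esum_(w in @reduced_loop _ _ _ D) (wt s w)%:E < +oo)%E.
  rewrite (esumID [set [::]])//; apply: lte_add_pinfty.
    apply: (@le_lt_trans _ _ (\esum_(w in [set [::] : seq letter]) (wt s w)%:E)%E).
      by apply: esum_subset => // w [].
    by rewrite esum_set1// ltry.
  pose P := (edge D * edge D)%type.
  pose T := (P * (set (isom X) * seq letter))%type.
  pose good (p : P) := [&& p.1 \in trim D, p.2 \in trim D & orig (graph D) p.1 == base D].
  pose A (p : P) := @ecosets _ _ _ D p.1.
  pose B (p : P) := [set w | fpath allowedD p.1 w p.2].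
  pose wA (p : P) c := expR (- s * edge_length o p.1 c).
  apply: (@le_lt_trans _ _ (\esum_(p in [set p | good p])
      \esum_(q in A p `*` B p) (wA p q.1 * wt s q.2)%:E)%E).
    have wpos p q : (0 <= (wA p q.1 * wt s q.2)%:E)%E.
      by rewrite lee_fin mulr_ge0 ?expR_ge0.
    rewrite esum_esum//.
    apply: (@esum_le_cover _ _ _ _ _ _ _ (fun t : T => (t.1.1, t.2.1) :: t.2.2)) => //.
    move=> [|[f c] w] [lw w0]; first by case: w0.
    have lT := reduced_loop_trim lw.
    case: lw => fb fc /coset_pathP[g wg gb].
    exists ((f, g), (c, w)); split=> //; last by rewrite wt_cons.
    split=> //; rewrite /good /= lT ?mem_head// fb eqxx andbT/=.
    have [_ <-] := (fpathE _ _ _ _).1 wg.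
    by apply: lT; exact: (mem_last f (map fst w)).
  have fgood : finite_set [set p | good p] by exact: finite_finset.
  rewrite esum_fset//; last first.
    by move=> p _; apply: esum_ge0 => q _; rewrite lee_fin mulr_ge0 ?expR_ge0.
  rewrite fsbig_finite//= big_seq; apply: sum_lty => p.
  rewrite in_fset_set// inE => /and3P[p1 p2 pb].
  apply: esum_prod_lty => [c _|w _||]; rewrite ?expR_ge0//; last exact: Ps.
  by have := ufin _ p1; rewrite /ucoef pb.
apply: le_lt_trans (@esum_prod_lty _ _ _ (@reduced_loop _ _ _ D) (vgroup (base D)) (wt s)
  (fun k => expR (- s * mdist o (k o))) _ _ loops Vfin).
- apply: (@esum_le_cover _ _ _ _ _ _ _ (fun p => word_elt m p.1 * p.2)%g).
    move=> h Hh; have [[w k] nf] := normal_form_exists hH mc Hh.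
    case: (nf) => /= lw vk hE; exists (w, k); split=> //.
    by rewrite hE -[(\prod_(_ <- _) _)%g]/(word_elt m w) BS_lengthE// /wt mulrDr expRD.
  by move=> p _; rewrite lee_fin mulr_ge0 ?expR_ge0.
- by move=> w _; exact: expR_ge0.
- by move=> k _; exact: expR_ge0.
Qed.

Lemma coef_finite_mono s s' : s <= s' -> coef_finite s -> coef_finite s'.
Proof.
move=> ss' [V u K]; split.
- apply: le_lt_trans V; apply: le_esum => k _.
  by rewrite lee_fin expR_weight_le ?mdist_ge0.
- move=> f /u; rewrite /ucoef; case: ifP => // _; apply: le_lt_trans.
  by apply: le_esum => c _; rewrite lee_fin expR_weight_le ?edge_length_ge0.
- move=> e f eT fT; apply: le_lt_trans (K e f eT fT).
  by apply: le_esum => c _; rewrite lee_fin expR_weight_le ?edge_length_ge0.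
Qed.

Lemma spectral_radius_mono_exponent C F s s' : s <= s' ->
  (spectral_radius (block C (Kmat_on o F s)) < 1)%E ->
  (spectral_radius (block C (Kmat_on o F s')) < 1)%E.
Proof.
move=> ss'; apply: spectral_radius_block_mono => e f _ _; rewrite Kmat_on_ge0/=.
by apply: le_esum => c _; rewrite lee_fin expR_weight_le ?edge_length_ge0.
Qed.

Variables (Gam : set (isom X)) (delta : R).
Hypothesis HGam : H `<=` Gam.
Hypothesis hdelta : critical_exponent o Gam = delta%:E.

(** Convergence of the normal-form series forces all the other conditions at the
    same exponent. Conversely, above the right-hand side, truncated blocks control
    closed paths, closed paths control all paths, and these with the coefficient
    series control the normal-form series. *)
Lemma BS_exponent_formulaP : BS_exponent_formula o m.
Proof.
rewrite /BS_exponent_formula; apply/eqP; rewrite eq_le; apply/andP; split; last first.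
  rewrite ge_max; apply/andP; split.
    by apply: inf_pos_mono => s _ BS; have := BS_summable_coef BS.
  apply: bigmax_le => [|C CC]; first exact: inf_pos_ge0.
  apply: ge_ereal_sup => _ [F [_ FC] <-]; apply: inf_pos_mono => s _ BS.
  exact: summable_paths_spectral_radius (component_sub CC) FC (BS_summable_paths BS).
set M := Order.max _ _.
have M0 : (0 <= M)%E by rewrite le_max inf_pos_ge0.
have key s : (M < s%:E)%E -> (BS_exponent o m <= s%:E)%E.
  move=> Ms; have s0 : 0 < s by rewrite -lte_fin (le_lt_trans M0).
  apply: inf_pos_le => //.
  (* The truncations are controlled at s1 only; the step from s1 to s makes the
     sum over all lengths converge. *)
  have [s1 [Ms1 s1s]] : exists s1, (M < s1%:E)%E /\ s1 < s.
    move: M0 Ms; case: M => [r| |]//= _; rewrite lte_fin => rs.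
    by exists ((r + s) / 2); rewrite lte_fin; split; lra.
  have [s2 [_ s21 coef2]] : exists s2, [/\ 0 < s2, s2 < s1 & coef_finite s2].
    apply: inf_pos_lt; apply: le_lt_trans Ms1; by rewrite /M le_max lexx.
  have coefs := coef_finite_mono (ltW (lt_trans s21 s1s)) coef2.
  apply: coef_paths_BS_summable => //.
  have [N N0 long] := wlen_ge_div hH D HGam hdelta.
  apply: summable_paths_of_closed => [|e eT]; first by case: coefs.
  have [[w wp w0]|none] := pselect (exists2 w, fpath allowedD e w e & w <> [::]).
    have [CC eC] := closed_word_component o eT wp w0.
    apply: (closed_paths_lty N0 long s1s) => n.
    apply: (psum_closed_le1_finite _ CC eC) => F fF FC.
    have [s3 [_ s31 rho3]] : exists s3, [/\ 0 < s3, s3 < s1 &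
        (spectral_radius (block (component o e) (Kmat_on o F s3)) < 1)%E].
      apply: inf_pos_lt; apply: le_lt_trans Ms1; rewrite /M le_max; apply/orP; right.
      apply: le_trans (le_bigmax_cond _ _ CC); apply: ereal_sup_ubound.
      by exists F.
    exact: spectral_radius_mono_exponent (ltW s31) rho3.
  apply: (@le_lt_trans _ _ (\esum_(w in [set [::] : seq letter]) (wt s w)%:E)%E).
    apply: esum_subset => // w wp; apply: contrapT => w0.
    by apply: none; exists w.
  by rewrite esum_set1// ltry.
case: M M0 key => [r| |]// _ key; last exact: leey.
apply/lee_addgt0Pr => d d0; rewrite -EFinD; apply: key.
by rewrite lte_fin ltrDl.
Qed.
End NormalFormSums.

Section Blocks.
Context {R : realType} {X : metricType R} {H : set (isom X)}.
Hypothesis hH : subgroup H.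
Variable D : graph_of_groups H.
Variable o : X.
Local Notation allowedD := (@allowed _ _ _ D).
Local Notation wt := (@word_wt _ _ _ D o).
Implicit Types (e f g : edge D) (s : R) (F : set (transition D)) (C : {set edge D}).
Hint Resolve wtE_ge0 : core.
Variables (Gam : set (isom X)) (delta : R).
Hypothesis HGam : H `<=` Gam.
Hypothesis hdelta : critical_exponent o Gam = delta%:E.
Hypothesis delta0 : 0 < delta.

Lemma Kmat_block C s : block C (Kmat o s) = block C (Kmat_on o (transitions_in C) s).
Proof.
apply/matrixP => i j; rewrite !mxE /Kmat /Kmat_on; congr esum.
by apply/seteqP; split=> c /= => [|[]//]; split=> //=; exact: enum_valP.
Qed.

Lemma spectral_radius_gt C F s : C \in components D o -> F `<=` transitions_in C ->
  delta < s -> (spectral_radius (block C (Kmat_on o F s)) < 1)%E.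
Proof.
move=> CC FC ds; apply: summable_paths_spectral_radius (component_sub CC) FC _.
exact: (summable_paths_gt hH HGam hdelta (ltW (lt_trans delta0 ds)) ds).
Qed.

(** At the critical exponent the closed path sums of each length are still at
    most 1, and strong connectedness bounds the others. *)
Lemma psum_critical_bounded C : C \in components D o -> exists K : R,
  forall n e f, e \in C -> f \in C ->
    (psum o (transitions_in C) delta n e f <= K%:E)%E.
Proof.
move=> CC.
have closed n e : e \in C -> (psum o (transitions_in C) delta n e e <= 1)%E.
  move=> eC; apply: psum_limit => s ds.
  apply: (@psum_closed_le1 _ _ _ _ _ C) => //; exact: spectral_radius_gt.
have bnd e f : exists K : R, 0 <= K /\ (e \in C -> f \in C -> forall n,
    (psum o (transitions_in C) delta n e f <= K%:E)%E).
  have [/andP[eC fC]|nC] := boolP ((e \in C) && (f \in C)); last first.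
    by exists 0; split=> // eC fC; rewrite eC fC in nC.
  have [p pp] := component_connected CC fC eC.
  exists (wt delta p)^-1; rewrite invr_ge0 wt_ge0; split=> // _ _ n.
  rewrite -[leRHS]mule1.
  apply: le_trans (lee_wpmul2l _ (closed (n + size p)%N e eC)); last first.
    by rewrite lee_fin invr_ge0 wt_ge0.
  rewrite -esumZ ?invr_ge0 ?wt_ge0//.
  apply: (@esum_le_inj _ _ _ _ _ _ _ (fun w => w ++ p)).
  - move=> w [<- wp]; rewrite /= size_cat; split=> //.
    by apply/fpath_cat; exists f.
  - by move=> w w' _ _ /cat_inj_l.
  - move=> w _; rewrite -EFinM lee_fin wt_cat mulrCA mulVf ?mulr1//.
    by rewrite gt_eqF// wt_gt0.
  - by move=> w _; rewrite mule_ge0// lee_fin invr_ge0 wt_ge0.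
pose K e f := projT1 (cid (bnd e f)).
have KP e f := projT2 (cid (bnd e f)) : 0 <= K e f /\ _.
exists (\sum_e \sum_f K e f) => n e f eC fC.
have [_ /(_ eC fC n)] := KP e f; move/le_trans; apply; rewrite lee_fin.
rewrite (bigD1 e)//= (bigD1 f)//= -addrA lerDl addr_ge0//.
  by apply: sumr_ge0 => g _; case: (KP e g).
by apply: sumr_ge0 => g _; apply: sumr_ge0 => h _; case: (KP g h).
Qed.

Lemma block_boundP : block_bound D o delta.
Proof.
move=> C CC; have [K bnd] := psum_critical_bounded CC.
have Kfin : finite_on C (Kmat_on o (transitions_in C) delta).
  move=> e f eC fC; rewrite ge0_fin_numE ?Kmat_on_ge0//.
  apply: le_lt_trans (le_lt_trans (bnd 1%N e f eC fC) (ltry _)).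
  apply: (@esum_le_inj _ _ _ _ _ _ _ (fun c => [:: (f, c)])) => //.
  - by move=> c c' _ _ [].
  - by move=> c _; rewrite wt1.
split.
- move=> e f eC fC; have := Kfin e f eC fC.
  suff -> : Kmat o delta e f = Kmat_on o (transitions_in C) delta e f by [].
  by rewrite /Kmat /Kmat_on; congr esum; apply/seteqP; split=> c /= => [|[]//].
- by move=> s ds; rewrite Kmat_block; exact: spectral_radius_gt.
- rewrite Kmat_block spectral_radius_block_le// lee_fin.
  apply: (@spectral_radius_le1 _ _ _ K) => n i j.
  rewrite ger0_norm; last by apply: nneg_mx_pow_ge0; exact: real_block_ge0.
  by rewrite -lee_fin -psumE// bnd//; exact: enum_valP.
Qed.

Lemma axis_comparisonP :
  (forall g : isom X, hyperbolic g -> mdist o (g o) <= axis_length o g) ->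
  axis_comparison D o delta.
Proof.
move=> axis_le C CC F g [fF FC gP].
have AK s e f : 0 < s -> (0 <= Amat o F g s e f <= Kmat_on o F s e f)%E.
  move=> s0; rewrite esum_ge0/= => [|c _]; last by rewrite lee_fin expR_ge0.
  apply: le_esum => c /= Fc; have [hyp [k ck gE]] := gP _ _ _ Fc.
  rewrite lee_fin ler_expR ler_wnM2l ?oppr_le0 ?(ltW s0)//.
  apply: le_trans (axis_le _ hyp); rewrite gE; exact: edge_length_le.
split; first by move=> s s0 e f _ _; have /andP[] := AK s e f s0.
split.
  apply: inf_pos_mono => s s0; apply: spectral_radius_block_mono => e f _ _.
  exact: AK.
apply/lee_addgt0Pr => d d0; rewrite -EFinD.
apply: inf_pos_le; first exact: addr_gt0.
by apply: spectral_radius_gt => //; rewrite ltrDl.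
Qed.
End Blocks.

(** * Comparison triangles in the hyperbolic plane *)

Section HyperbolicPlane.
Context {R : realType}.
Implicit Types (u v t : R).

Definition cosh u : R := (expR u + expR (- u)) / 2.
Definition sinh u : R := (expR u - expR (- u)) / 2.

Lemma cosh_sinhE u : cosh u ^+ 2 = 1 + sinh u ^+ 2.
Proof.
have : expR u * expR (- u) = 1 by rewrite -expRD subrr expR0.
rewrite /cosh /sinh; move: (expR u) (expR (- u)) => x y xy; nra.
Qed.
Lemma coshD u v : cosh (u + v) = cosh u * cosh v + sinh u * sinh v.
Proof. by rewrite /cosh /sinh opprD !expRD; field. Qed.
Lemma sinhD u v : sinh (u + v) = sinh u * cosh v + cosh u * sinh v.
Proof. by rewrite /cosh /sinh opprD !expRD; field. Qed.
Lemma coshN u : cosh (- u) = cosh u.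
Proof. by rewrite /cosh opprK addrC. Qed.
Lemma sinhN u : sinh (- u) = - sinh u.
Proof. by rewrite /sinh opprK -mulNr opprB. Qed.
Lemma coshB u v : cosh (u - v) = cosh u * cosh v - sinh u * sinh v.
Proof. by rewrite coshD coshN sinhN mulrN. Qed.
Lemma cosh0 : cosh 0 = 1.
Proof. by rewrite /cosh oppr0 expR0; field. Qed.
Lemma sinh0 : sinh 0 = 0.
Proof. by rewrite /sinh oppr0 subrr mul0r. Qed.
Lemma cosh_gt0 u : 0 < cosh u.
Proof. by rewrite divr_gt0// addr_gt0// expR_gt0. Qed.
Lemma cosh_ge1 u : 1 <= cosh u.
Proof. have := cosh_sinhE u; have := cosh_gt0 u; have := sqr_ge0 (sinh u); nra. Qed.
Lemma sinh_ge0 u : 0 <= u -> 0 <= sinh u.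
Proof. by move=> u0; rewrite divr_ge0// subr_ge0 ler_expR; lra. Qed.
Lemma sinh_gt0 u : 0 < u -> 0 < sinh u.
Proof. by move=> u0; rewrite divr_gt0// subr_gt0 ltr_expR; lra. Qed.
Lemma sinh_lt_cosh u : `|sinh u| < cosh u.
Proof.
rewrite ltr_norml; apply/andP; rewrite /sinh /cosh.
by split; have := expR_gt0 u; have := expR_gt0 (- u); lra.
Qed.
Lemma cosh_le u v : 0 <= u -> u <= v -> cosh u <= cosh v.
Proof.
move=> u0 uv; rewrite -(subrKC u v) coshD.
have := sinh_ge0 u0; have vu : 0 <= v - u by lra.
have := sinh_ge0 vu; have := cosh_ge1 (v - u); have := cosh_gt0 u; nra.
Qed.
Lemma sinh_le u v : 0 <= u -> u <= v -> sinh u <= sinh v.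
Proof.
move=> u0 uv; have := cosh_le u0 uv.
have v0 := le_trans u0 uv; have := sinh_ge0 u0; have := sinh_ge0 v0.
have := cosh_sinhE u; have := cosh_sinhE v; have := cosh_gt0 u; nra.
Qed.

Lemma arcosh_cosh u : arcosh (cosh u) = `|u|.
Proof.
wlog u0 : u / 0 <= u => [h|].
  have [/h//|/ltW u0] := leP 0 u.
  by rewrite -coshN h ?normrN ?oppr_ge0.
rewrite /arcosh cosh_sinhE [1 + _]addrC addrK sqrtr_sqr !ger0_norm ?sinh_ge0//.
have -> : cosh u + sinh u = expR u by rewrite /cosh /sinh; field.
by rewrite expRK.
Qed.

Lemma arcosh_le u v : 1 <= u -> u <= v -> arcosh u <= arcosh v.
Proof.
move=> u1 uv; have u0 : 0 < u by lra.
have v0 : 0 < v by lra.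
rewrite /arcosh ler_ln ?posrE ?ltr_wpDr ?sqrtr_ge0//.
by rewrite lerD// ler_wsqrtr// lerB// !expr2 ler_pM// ltW.
Qed.

(** The hyperboloid model: vectors of square 1 for the Lorentz form, mapped to
    the upper half-plane by projection from a boundary point. *)
Definition lorentz (p q : R * R * R) : R :=
  p.1.1 * q.1.1 - p.1.2 * q.1.2 - p.2 * q.2.

Definition on_sheet (p : R * R * R) := lorentz p p = 1 /\ 0 < p.1.1 - p.1.2.

Lemma hpoint_subproof (p : R * R * R) :
  0 < (if 0 < p.1.1 - p.1.2 then (p.1.1 - p.1.2)^-1 else 1).
Proof. by case: ifPn => // p0; rewrite invr_gt0. Qed.

(** The conditional in the imaginary part makes this total: on the sheet it is
    the inverse of the difference of the first two coordinates. *)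
Definition hpoint (p : R * R * R) : hplane R :=
  HPlane (p.2 / (p.1.1 - p.1.2)) (hpoint_subproof p).

Lemma hdist_hpoint p q : on_sheet p -> on_sheet q ->
  hdist (hpoint p) (hpoint q) = arcosh (lorentz p q).
Proof.
case: p q => [[x0 x1] x2] [[y0 y1] y2] [/= px xp] [/= py yp].
rewrite /hdist /= xp yp; congr arcosh; move: px py; rewrite /lorentz /= => px py.
have ex : x0 + x1 = (1 + x2 ^+ 2) / (x0 - x1).
  by apply: (mulIf (lt0r_neq0 xp)); rewrite divfK ?gt_eqF//; lra.
have ey : y0 + y1 = (1 + y2 ^+ 2) / (y0 - y1).
  by apply: (mulIf (lt0r_neq0 yp)); rewrite divfK ?gt_eqF//; lra.
have -> : x0 * y0 - x1 * y1 - x2 * y2 =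
  ((x0 + x1) * (y0 - y1) + (x0 - x1) * (y0 + y1)) / 2 - x2 * y2 by field.
rewrite ex ey; field.
by rewrite !gt_eqF.
Qed.

(** Both orientations are needed to run around a triangle cyclically. *)
Lemma hgeodesic (p : R -> R * R * R) u v : u <= v ->
  (forall t, on_sheet (p t)) -> (forall s t, lorentz (p s) (p t) = cosh (s - t)) ->
  geodesic_path (@hdist R) (hpoint (p u)) (hpoint (p v)) (fun t => hpoint (p (t + u))) /\
  geodesic_path (@hdist R) (hpoint (p v)) (hpoint (p u)) (fun t => hpoint (p (v - t))).
Proof.
move=> uv ps pp.
have d s t : hdist (hpoint (p s)) (hpoint (p t)) = `|s - t|.
  by rewrite hdist_hpoint// pp arcosh_cosh.
split; split.
- by rewrite add0r.
- by rewrite d distrC ger0_norm ?subr_ge0// subrK.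
- by move=> s t _ _; rewrite d; congr `|_|; ring.
- by rewrite subr0.
- by rewrite d ger0_norm ?subr_ge0// opprB subrKC.
- by move=> s t _ _; rewrite d distrC; congr `|_|; ring.
Qed.
End HyperbolicPlane.

(** * Axes of hyperbolic isometries *)

Section IsoscelesTriangle.
Context {R : realType}.
Implicit Types (t : R).

(** The sine [d] and cosine [c] of half the apex angle of an isosceles triangle
    with legs [a] and base [b]. *)
Lemma half_apex_angle (a b : R) : 0 < a -> 0 <= b -> b <= 2 * a ->
  exists c d : R, [/\ 0 <= c, c ^+ 2 + d ^+ 2 = 1 & sinh a * d = sinh (b / 2)].
Proof.
move=> a0 b0 ba; have sa : 0 < sinh a by exact: sinh_gt0.
have b20 : 0 <= b / 2 by lra.
have ba2 : b / 2 <= a by lra.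
have sb := sinh_ge0 b20; have sba := sinh_le b20 ba2.
exists (Num.sqrt (1 - (sinh (b / 2) / sinh a) ^+ 2)), (sinh (b / 2) / sinh a); split.
- exact: sqrtr_ge0.
- rewrite sqr_sqrtr ?subrK// subr_ge0 (expr_le1 _ (divr_ge0 sb (ltW sa)))//.
  by rewrite ler_pdivrMr// mul1r.
- by rewrite mulrCA mulfV ?mulr1// gt_eqF.
Qed.

(** The isosceles triangle with its apex at (1, 0, 0) and its axis of symmetry
    along the second coordinate. *)
Variables a b c d : R.
Hypotheses (a0 : 0 < a) (b0 : 0 <= b) (ba : b <= 2 * a).
Hypotheses (c0 : 0 <= c) (cd : c ^+ 2 + d ^+ 2 = 1) (sd : sinh a * d = sinh (b / 2)).

Let c1 : c <= 1. Proof. move: c0 cd (sqr_ge0 d); nra. Qed.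

(** The leg leaving the apex on the side [e = 1] or [e = -1]. *)
Definition leg (e : R) t : R * R * R := (cosh t, sinh t * c, e * (sinh t * d)).

Definition base_line t : R * R * R :=
  (cosh t * (cosh a / cosh (b / 2)), cosh t * (sinh a * c / cosh (b / 2)), sinh t).

Lemma lorentz_leg (e : R) s t : e ^+ 2 = 1 -> lorentz (leg e s) (leg e t) = cosh (s - t).
Proof.
move=> e1; rewrite /lorentz /leg /= coshB.
transitivity (cosh s * cosh t - sinh s * sinh t * (c ^+ 2 + e ^+ 2 * d ^+ 2)); first by ring.
by rewrite e1 mul1r cd mulr1.
Qed.

Lemma on_sheet_leg (e : R) t : e ^+ 2 = 1 -> on_sheet (leg e t).
Proof.
move=> e1; split; first by rewrite lorentz_leg// subrr cosh0.
rewrite /= subr_gt0; apply: le_lt_trans (sinh_lt_cosh t).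
apply: le_trans (ler_norm _) _; rewrite normrM ler_piMr//.
by rewrite ger0_norm.
Qed.

Lemma lorentz_base s t : lorentz (base_line s) (base_line t) = cosh (s - t).
Proof.
rewrite /lorentz /base_line /= coshB.
have chb : cosh (b / 2) != 0 by rewrite gt_eqF ?cosh_gt0.
have e1 : (sinh a * c) ^+ 2 = sinh a ^+ 2 - sinh (b / 2) ^+ 2.
  have cE : c ^+ 2 = 1 - d ^+ 2 by rewrite -cd addrK.
  by rewrite exprMn cE -sd; ring.
have e2 : cosh a ^+ 2 - (sinh a * c) ^+ 2 = cosh (b / 2) ^+ 2 by rewrite e1 !cosh_sinhE; ring.
transitivity (cosh s * cosh t * ((cosh a ^+ 2 - (sinh a * c) ^+ 2) / cosh (b / 2) ^+ 2) - sinh s * sinh t).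
  by field.
by rewrite e2 divff ?mulr1// expf_neq0.
Qed.

Lemma on_sheet_base t : on_sheet (base_line t).
Proof.
split; first by rewrite lorentz_base subrr cosh0.
rewrite /= -mulrBr -mulrBl mulr_gt0 ?cosh_gt0// divr_gt0 ?cosh_gt0// subr_gt0.
apply: le_lt_trans (sinh_lt_cosh a).
by rewrite (le_trans (ler_norm _))// normrM ler_piMr// ger0_norm.
Qed.

Lemma leg_apex (e : R) : leg e 0 = (1, 0, 0).
Proof. by rewrite /leg cosh0 sinh0 !mul0r mulr0. Qed.

Lemma base_right : base_line (b / 2) = leg 1 a.
Proof.
have chb : cosh (b / 2) != 0 by rewrite gt_eqF ?cosh_gt0.
by rewrite /base_line /leg sd mul1r; congr (_, _, _); field.
Qed.

Lemma base_left : base_line (- (b / 2)) = leg (-1) a.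
Proof.
have chb : cosh (b / 2) != 0 by rewrite gt_eqF ?cosh_gt0.
by rewrite /base_line /leg sd coshN sinhN mulN1r; congr (_, _, _); field.
Qed.

(** With Y = cosh (b / 2) and A = 2 cosh^2 (a / 2) = cosh a + 1 the claim reads
    1 + (Y^2 - 1) / A <= Y, that is Y + 1 <= A, which is b / 2 <= a. *)
Lemma leg_midpoints :
  hdist (hpoint (leg 1 (a / 2))) (hpoint (leg (-1) (a / 2))) <= b / 2.
Proof.
have e1 : (1 : R) ^+ 2 = 1 by rewrite expr1n.
have e2 : (- 1 : R) ^+ 2 = 1 by rewrite sqrrN expr1n.
rewrite hdist_hpoint; [|exact: on_sheet_leg..].
have b20 : 0 <= b / 2 by rewrite divr_ge0.
rewrite -[leRHS](@ger0_norm _ (b / 2))// -arcosh_cosh.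
set h := a / 2; have ah : a = h + h by rewrite /h; field.
have h0 : 0 < h by rewrite divr_gt0.
have shh := sinh_gt0 h0; have chh := cosh_gt0 h.
have -> : lorentz (leg 1 h) (leg (-1) h) = 1 + 2 * (sinh h * d) ^+ 2.
  rewrite /lorentz /leg /=.
  transitivity (cosh h ^+ 2 - sinh h ^+ 2 * (c ^+ 2 + d ^+ 2) + 2 * (sinh h * d) ^+ 2); first by ring.
  by rewrite cd cosh_sinhE; ring.
have hd : 2 * cosh h * (sinh h * d) = sinh (b / 2).
  by rewrite -sd ah sinhD; ring.
have hd2 : (2 * cosh h ^+ 2) * (2 * (sinh h * d) ^+ 2) = cosh (b / 2) ^+ 2 - 1.
  by rewrite [in RHS]cosh_sinhE -hd; ring.
have Y1 := cosh_ge1 (b / 2).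
have YA : cosh (b / 2) <= 2 * cosh h ^+ 2 - 1.
  have -> : 2 * cosh h ^+ 2 - 1 = cosh a by rewrite ah coshD -!expr2 cosh_sinhE; ring.
  by apply: cosh_le => //; rewrite ler_pdivrMr// mulrC.
apply: arcosh_le; first by rewrite lerDl mulr_ge0// sqr_ge0.
move: hd2 YA Y1; set Y := cosh (b / 2); set x := 2 * (sinh h * d) ^+ 2.
set A := 2 * cosh h ^+ 2 => hd2 YA Y1.
have A0 : 0 < A by lra.
rewrite -(ler_pM2l A0) mulrDr hd2; nra.
Qed.
End IsoscelesTriangle.

Section Axis.
Context {R : realType} {X : metricType R}.
Hypothesis hcat : cat_minus1 X.
Implicit Types (g : isom X) (z : X).

(** CAT(-1) comparison of the midpoints of the legs of the isosceles triangle
    z, g z, g^2 z. This is where the curvature bound enters. *)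
Lemma midpoint_displacement g z (c : R -> X) : geodesic_path mdist z (g z) c ->
  mdist (c (mdist z (g z) / 2)) (g (c (mdist z (g z) / 2))) <= mdist z (g (g z)) / 2.
Proof.
move=> cz; set a := mdist z (g z); set b := mdist z (g (g z)).
have ga : mdist (g z) (g (g z)) = a by rewrite isom_dist.
have ba : b <= 2 * a.
  by rewrite mulr_natl mulr2n -{2}ga; exact: metric_triangle.
have b0 : 0 <= b by exact: mdist_ge0.
have [a0|a0] := ltP 0 a; last first.
  have a00 : a = 0 by apply/eqP; rewrite eq_le a0 mdist_ge0.
  have [cz0 _ _] := cz.
  by rewrite a00 mul0r cz0 -/a a00 divr_ge0.
have [p [q [p0 pq aq]]] := half_apex_angle a0 b0 ba.
have [geod cmp] := hcat; have [cb cbP] := geod (g (g z)) z.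
pose v (i : 'I_3) := nth z [:: z; g z; g (g z)] i.
pose cc (i : 'I_3) := nth c [:: c; g \o c; cb] i.
pose v' (i : 'I_3) := nth (hpoint (leg p q 1 a))
  [:: hpoint (leg p q 1 a); hpoint (leg p q 1 0); hpoint (leg p q (-1) a)] i.
pose c1' t := hpoint (leg p q 1 (a - t)).
pose c2' t := hpoint (leg p q (-1) (t + 0)).
pose c3' t := hpoint (base_line a b p (t + - (b / 2))).
pose cc' (i : 'I_3) := nth c1' [:: c1'; c2'; c3'] i.
have e1 : (1 : R) ^+ 2 = 1 by rewrite expr1n.
have e2 : (- 1 : R) ^+ 2 = 1 by rewrite sqrrN expr1n.
have leg1 := fun s t => lorentz_leg pq s t e1.
have leg2 := fun s t => lorentz_leg pq s t e2.
have [g1 g1'] := hgeodesic (ltW a0) (fun t => on_sheet_leg p0 pq t e1) leg1.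
have [g2 g2'] := hgeodesic (ltW a0) (fun t => on_sheet_leg p0 pq t e2) leg2.
have bb : - (b / 2) <= b / 2 by lra.
have [g3 g3'] := hgeodesic bb (on_sheet_base p0 pq aq) (lorentz_base pq aq).
rewrite (base_right p aq) (base_left p aq) in g3 g3'.
have T : geodesic_triangle mdist v cc.
  case=> [[|[|[|//]]] i3]; rewrite /v /cc /=.
  - exact: cz.
  - have [cz0 cz1 czd] := cz; split=> /=; first by rewrite cz0.
      by rewrite ga cz1.
    by move=> s t; rewrite ga => sa ta; rewrite isom_dist; exact: czd.
  - exact: cbP.
have T' : geodesic_triangle (@hdist R) v' cc'.
  case=> [[|[|[|//]]] i3]; rewrite /v' /cc' /=.
  - exact: g1'.
  - by move: g2; rewrite !leg_apex.
  - exact: g3.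
have dd i : hdist (v' i) (v' (i + 1)) = mdist (v i) (v (i + 1)).
  case: i => [[|[|[|//]]] i3]; rewrite /v' /v /=.
  - rewrite hdist_hpoint; [|exact: on_sheet_leg..].
    by rewrite leg1 arcosh_cosh subr0 ger0_norm ?ltW.
  - rewrite (leg_apex _ _ 1) -(leg_apex p q (-1)) hdist_hpoint; [|exact: on_sheet_leg..].
    by rewrite leg2 arcosh_cosh sub0r normrN ger0_norm ?ltW// ga.
  - rewrite -(base_right p aq) -(base_left p aq) hdist_hpoint; [|exact: (on_sheet_base p0 pq aq)..].
    rewrite (lorentz_base pq aq) arcosh_cosh metric_sym -/b -opprD normrN.
    by rewrite -splitr ger0_norm.
have h2 : 0 <= a / 2 <= a by lra.
have := cmp v cc v' cc' T T' dd 0 1 (a / 2) (a / 2).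
rewrite /v /cc /cc' /c1' /c2' /= ga -/a => /(_ h2 h2) /le_trans; apply.
rewrite addr0 (_ : a - a / 2 = a / 2); last by field.
exact: (leg_midpoints a0 b0 ba p0 pq aq).
Qed.

Lemma transl_length_le g z : transl_length g <= mdist z (g z).
Proof.
apply: ge_inf; last by exists z.
by exists 0 => _ [y _ <-]; exact: mdist_ge0.
Qed.

(** The midpoint of a segment from y to g y is displaced by at least the
    translation length of g and by at most half the displacement of y by g^2. *)
Lemma transl_length_sqr g z : mdist z (g z) = transl_length g ->
  transl_length (g * g)%g = 2 * transl_length g /\
  mdist z ((g * g)%g z) = transl_length (g * g)%g.
Proof.
move=> gz; have lb y : 2 * transl_length g <= mdist y ((g * g)%g y).
  have [geod _] := hcat; have [c cP] := geod y (g y).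
  have := midpoint_displacement cP; have := transl_length_le g (c (mdist y (g y) / 2)).
  rewrite -[(g * g)%g y]/(g (g y)); lra.
have zz : mdist z ((g * g)%g z) = 2 * transl_length g.
  apply/eqP; rewrite eq_le lb andbT -[(g * g)%g z]/(g (g z)).
  have := metric_triangle z (g z) (g (g z)); rewrite isom_dist gz; lra.
have tE : transl_length (g * g)%g = 2 * transl_length g.
  apply/eqP; rewrite eq_le -{1}zz transl_length_le/=.
  apply: lb_le_inf; first by exists (mdist z ((g * g)%g z)), z.
  by move=> _ [y _ <-]; exact: lb.
by rewrite tE.
Qed.

Lemma iter_isom_dist g k x y : mdist (iter k g x) (iter k g y) = mdist x y.
Proof. by elim: k => //= k IH; rewrite isom_dist. Qed.

Lemma orbit_displacement_le g z k : mdist z (iter k g z) <= k%:R * mdist z (g z).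
Proof.
elim: k => [|k IH]; first by rewrite mdistxx mul0r.
rewrite -natr1 mulrDl mul1r; apply: le_trans (metric_triangle _ (iter k g z) _) _.
by rewrite lerD//= -iterS iterSr iter_isom_dist.
Qed.

(** Repeated squaring settles the powers of two; another exponent is compared
    with a larger power of two by the triangle inequality. *)
Lemma orbit_displacement g z k : mdist z (g z) = transl_length g ->
  mdist z (iter k g z) = k%:R * transl_length g.
Proof.
move=> gz.
have pow j : mdist z (iter (2 ^ j) g z) = (2 ^ j)%:R * transl_length g.
  have [h [hE hz ht]] : exists h : isom X, [/\ (forall y, h y = iter (2 ^ j) g y),
      mdist z (h z) = transl_length h & transl_length h = (2 ^ j)%:R * transl_length g].
    elim: j => [|j [h [hE hz ht]]].
      by exists g; rewrite mul1r.
    have [sq1 sq2] := transl_length_sqr hz; exists (h * h)%g; split=> //.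
      move=> y; rewrite -[(h * h)%g y]/(h (h y)) !hE -iterD addnn -mul2n expnS//.
    by rewrite sq1 ht mulrA -natrM expnS.
  by rewrite -hE hz ht.
apply/eqP; rewrite eq_le -{1}gz orbit_displacement_le/=.
have kj : (k <= 2 ^ k)%N by exact: ltnW (ltn_expl _ _).
have := metric_triangle z (iter k g z) (iter (2 ^ k) g z); rewrite pow.
have -> : mdist (iter k g z) (iter (2 ^ k) g z) = mdist z (iter (2 ^ k - k) g z).
  by rewrite -{1}(subnKC kj) iterD iter_isom_dist.
have := orbit_displacement_le g z (2 ^ k - k); rewrite gz natrB// mulrBl; lra.
Qed.

(** The action of the [n]-th power of [g], for an integer [n]. *)
Definition zact g (n : int) : X -> X :=
  match n with Posz k => iter k g | Negz k => iter k.+1 (isom_inv g) end.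

Lemma zactS g n x : zact g (n + 1) x = g (zact g n x).
Proof.
case: n => [k|[|k]]; first by rewrite -PoszD addn1.
  by rewrite /= isom_invfunK.
rewrite (_ : Negz k.+1 + 1 = Negz k); last by rewrite !NegzE; lia.
by rewrite /= isom_invfunK.
Qed.

Lemma zact_comm g n x : zact g n (g x) = g (zact g n x).
Proof.
case: n => k; rewrite /zact; first by rewrite -iterS iterSr.
rewrite iterSr [iter k.+1 _ x]/= isom_invfunK; congr iter.
by apply: (@isom_inj _ _ g); rewrite /= isom_invfunK.
Qed.

Lemma zact_dist g n x y : mdist (zact g n x) (zact g n y) = mdist x y.
Proof. by case: n => k; rewrite /zact iter_isom_dist. Qed.

Lemma zact_iter g n k x : zact g (n + k%:Z) x = iter k g (zact g n x).
Proof.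
elim: k => [|k IH]; first by rewrite addr0.
by rewrite -addn1 PoszD addrA zactS IH addn1.
Qed.

Lemma zact_displacement g n z : mdist (zact g n z) (g (zact g n z)) = mdist z (g z).
Proof.
case: n => k /=; first by rewrite -iterS iterSr iter_isom_dist.
rewrite isom_invfunK -[X in mdist X _]/(iter k.+1 (isom_inv g) z) iterSr iter_isom_dist.
by rewrite -(isom_dist g) /= isom_invfunK metric_sym.
Qed.

(** The translates of a segment from z to g z are concatenated; since g^n
    displaces z by exactly n tau, no shortcut exists along this curve. *)
Lemma hyperbolic_axis_exists g : hyperbolic g -> exists A, is_axis g A.
Proof.
move=> [tau0 [z gz]]; set tau := transl_length g in tau0 gz *.
have [geod _] := hcat; have [c0 c0P] := geod z (g z).
case: c0P => c00; rewrite gz => c01 c0d.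
pose fl t := Num.floor (t / tau); pose u t := t - tau * (fl t)%:~R.
pose c t := zact g (fl t) (c0 (u t)).
have uP t : 0 <= u t < tau.
  have /andP[f1 f2] := Num.Theory.floor_itv (t / tau).
  rewrite /u subr_ge0 mulrC -ler_pdivlMr// f1/=.
  by move: f2; rewrite intrD ltr_pdivrMr//; rewrite mulrDl mul1r /fl; lra.
have Zd n k : mdist (zact g n z) (zact g (n + k%:Z) z) = k%:R * tau.
  by rewrite zact_iter orbit_displacement// zact_displacement.
have c0g y : 0 <= y <= tau -> mdist z (c0 y) = y /\ mdist (c0 y) (g z) = tau - y.
  move=> yt; have t0 : (0 : R) <= 0 <= tau by rewrite lexx ltW.
  have tt : 0 <= tau <= tau by rewrite lexx andbT ltW.
  rewrite -{1}c00 -c01 !c0d// sub0r normrN distrC.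
  by case/andP: yt => y0 y1; rewrite !ger0_norm ?subr_ge0.
have lineP s t : s <= t -> mdist (c s) (c t) = t - s.
  move=> st.
  have /andP[us0 us1] := uP s; have /andP[ut0 ut1] := uP t.
  have us : 0 <= u s <= tau by rewrite us0 ltW.
  have ut : 0 <= u t <= tau by rewrite ut0 ltW.
  have sE : s = u s + tau * (fl s)%:~R by rewrite subrK.
  have tE : t = u t + tau * (fl t)%:~R by rewrite subrK.
  have flst : (fl s <= fl t)%R by
    rewrite /fl Num.Theory.floor_ge_int (le_trans (Num.Theory.floor_le _))// ler_pM2r ?invr_gt0.
  have [k fk] : exists k : nat, fl t = fl s + k%:Z.
    by exists `|fl t - fl s|%N; rewrite gez0_abs ?subr_ge0// subrKC.
  have ts : t - s = u t - u s + k%:R * tau.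
    by rewrite [in LHS]sE [in LHS]tE fk intrD pmulrn; ring.
  case: k fk ts => [|k] fk ts.
    rewrite /c fk addr0 zact_dist c0d// distrC ts mul0r addr0 ger0_norm//.
    by move: st; rewrite -subr_ge0 ts mul0r addr0.
  have [zs sz] := c0g _ us; have [zt tz] := c0g _ ut.
  pose Z n := zact g n z.
  have Zn n : zact g n (g z) = Z (n + 1).
    by rewrite /Z zactS zact_comm.
  have d1 : mdist (Z (fl s)) (c s) = u s by rewrite /Z zact_dist.
  have d2 : mdist (c s) (Z (fl s + 1)) = tau - u s by rewrite -Zn zact_dist.
  have d3 : mdist (Z (fl t)) (c t) = u t by rewrite /Z zact_dist.
  have d4 : mdist (c t) (Z (fl t + 1)) = tau - u t by rewrite -Zn zact_dist.
  have d5 : mdist (Z (fl s + 1)) (Z (fl t)) = k%:R * tau.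
    by rewrite fk intS addrA Zd.
  have d6 : mdist (Z (fl s)) (Z (fl t + 1)) = k.+2%:R * tau.
    by rewrite fk -addrA -PoszD addn1 Zd.
  have t1 := metric_triangle (c s) (Z (fl s + 1)) (c t).
  have t2 := metric_triangle (Z (fl s + 1)) (Z (fl t)) (c t).
  have t3 := metric_triangle (Z (fl s)) (c s) (Z (fl t + 1)).
  have t4 := metric_triangle (c s) (c t) (Z (fl t + 1)).
  rewrite d1 d2 d3 d4 d5 d6 in t1 t2 t3 t4.
  apply/eqP; rewrite eq_le ts; move: t3; rewrite -!natr1 !mulrDl !mul1r => t3.
  apply/andP; split; lra.
exists (range c), c; split=> //.
- move=> s t; have [st|/ltW ts] := leP s t.
    by rewrite lineP// distrC ger0_norm ?subr_ge0.
  by rewrite metric_sym lineP// ger0_norm ?subr_ge0.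
- move=> t; rewrite /c.
  have flE : fl (t + tau) = fl t + 1.
    by rewrite /fl mulrDl divff ?gt_eqF// Num.Theory.floorDrz ?rpred1// Num.Theory.floor1.
  rewrite flE zactS; congr (g (zact _ _ (c0 _))).
  by rewrite /u flE intrD; ring.
Qed.

Lemma displacement_le_axis_length o g : hyperbolic g ->
  mdist o (g o) <= axis_length o g.
Proof.
move=> hyp; have ax : is_axis g (axis g).
  by apply: xgetPex; exact: hyperbolic_axis_exists.
case: ax => c [line trans axE].
rewrite /axis_length addrC -lerBlDr -ler_pdivrMl//.
apply: lb_le_inf; first by exists (mdist o (c 0)), (c 0); rewrite // axE; exists 0.
move=> _ [z + <-]; rewrite axE => -[t _ <-]; rewrite ler_pdivrMl// lerBlDr.
have := metric_triangle o (c t) (g o); have := metric_triangle (c t) (g (c t)) (g o).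
rewrite isom_dist (metric_sym (c t) o) trans line opprD addNKr normrN.
rewrite (ger0_norm (ltW (proj1 hyp))); lra.
Qed.
End Axis.

(** * The assertions at a node and along a hierarchy *)

Section Assertions.
Context {R : realType} {X : metricType R}.
Variables (Gam : set (isom X)) (o : X) (delta : R).
Hypotheses (hcat : cat_minus1 X) (hdelta : critical_exponent o Gam = delta%:E).
Hypothesis delta0 : 0 < delta.

Lemma BS_assertionsP (H : set (isom X)) (D : graph_of_groups H) :
  subgroup H -> H `<=` Gam -> BS_assertions D o delta.
Proof.
move=> hH HGam; split.
- by move=> m mP; exact: (BS_exponent_formulaP hH mP HGam hdelta).
- exact: (block_boundP hH HGam hdelta delta0).
- apply: (axis_comparisonP hH HGam hdelta delta0) => g.
  exact: displacement_le_axis_length.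
Qed.

Lemma hierarchy_assertions (H : set (isom X)) (T : hierarchy H) :
  subgroup H -> H `<=` Gam ->
  all_nonterminal (fun H' (D : graph_of_groups H') => BS_assertions D o delta) T.
Proof.
elim: T => [//|H' D sel children IH] hH HGam /=; split.
  exact: BS_assertionsP.
move=> v vS; apply: IH; first exact: subgroup_vgroup.
by move=> g [Hg _]; exact: HGam.
Qed.
End Assertions.

Theorem theorem1p3 (R : realType) (X : metricType R)
    (hproper : proper_space X) (hcat : cat_minus1 X)
    (Gam : set (isom X)) (hGam : subgroup Gam)
    (hfg : finitely_generated Gam) (hne : non_elementary Gam)
    (hdiscr : discrete_isom Gam)
    (A B : set (R -> X)) (hA : limit_set Gam A) (hB : limit_set Gam B)
    (hAB : A <> B) (o : X) (ho : on_geodesic A B o)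
    (delta : R) (hdelta : critical_exponent o Gam = delta%:E)
    (hdelta0 : 0 < delta) :
  (forall (I : Type) (hI : inhabited I) (H : I -> set (isom X))
      (hH : forall b, subgroup (H b)) (hHGam : forall b, H b `<=` Gam)
      (G : forall b, graph_of_groups (H b)) (b : I),
      BS_assertions (G b) o delta)
  /\
  (forall (H : set (isom X)) (hH : subgroup H) (hHGam : H `<=` Gam)
      (T : hierarchy H),
      all_nonterminal (fun H' (D : graph_of_groups H') => BS_assertions D o delta) T).
Proof.
split=> [I _ H hH HGam G b|H hH HGam T].
  exact: (BS_assertionsP hcat hdelta hdelta0).
exact: (hierarchy_assertions hcat hdelta hdelta0).
Qed.
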